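(* Let $k\ge 1$ be an integer and let $l$ be an integer with $\binom{k+2}{3}\le l<\binom{k+3}{3}$ which has at least one of the following forms: (1) $l=\binom{k+2}{3}+j$ for an integer $j$ with $0\le j\le (k+3)/2$; (2) $l=\binom{k+3}{3}-j$ for an integer $j$ with $1\le j\le 4$; (3) $l=\binom{k+3}{3}-\binom{b}{2}$ for some $b\in\{2,3,4,k+1,k+2\}$. Let $I=(x^{m_1},y^{m_2},z^{m_3},\text{mixed monomial generators})$ be a zero-dimensional Borel-fixed ideal of degree $l$ in $R=\mathbb{C}[x,y,z]$, where $m_1\le m_2\le m_3$. If $I$ corresponds to a point of maximal singularity of $\mathrm{Hilb}^l(\mathbb{A}^3)$, then $m_1=k$.
   Context: $R=\mathbb{C}[x,y,z]$. A monomial ideal $I\subset R$ is Borel-fixed (strongly stable) if, ordering the variables as $x_1=x,\ x_2=y,\ x_3=z$, for every minimal generator $g$ of $I$ and every $i$ with $x_i\mid g$, one has $x_j\,(g/x_i)\in I$ for all $1\le j<i$. The degree of a zero-dimensional ideal $J$ is $\dim_{\mathbb{C}}R/J$. $\mathrm{Hilb}^l(\mathbb{A}^3)$ is the Hilbert scheme of $l$ points on $\mathbb{A}^3$; its closed points $[J]$ correspond to zero-dimensional ideals $J\subset R$ of degree $l$, and the tangent space at $[J]$ has dimension $T(J)=\dim_{\mathbb{C}}\mathrm{Hom}_R(J,R/J)$. A point $[I]$ is of maximal singularity if $T(I)\ge T(J)$ for all ideals $J\subset R$ of degree $l$. For a zero-dimensional monomial ideal $I$, the numbers $m_1,m_2,m_3$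 are the exponents of the minimal generators of $I$ that are pure powers of $x,y,z$ respectively. *)

(* Defs.v *)
From HB Require Import structures.
From mathcomp Require Import all_boot all_order all_algebra.
From mathcomp Require Import ring_quotient.
From mathcomp Require Import mpoly complex.
From mathcomp Require Import boolp reals.

Set Implicit Arguments.
Unset Strict Implicit.
Unset Printing Implicit Defensive.

Import GRing.Theory.
Local Open Scope ring_scope.
Local Open Scope quotient_scope.

(* The same abelian group as [V], with scalars restricted along [f]; an alias
   is needed because the carrier [V] already holds its own module structure. *)
Definition restrict_scalars (K A : nzRingType) (f : {rmorphism K -> A})
  (V : lmodType A) : Type := V.

Section RestrictScalars.
Variables (K A : nzRingType) (f : {rmorphism K -> A}) (V : lmodType A).
Local Notation W := (restrict_scalars f V).

HB.instance Definition _ := GRing.Zmodule.copy W V.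

Definition restrict_scale (c : K) (v : W) : W := f c *: (v : V).

Fact restrict_scaleA c d v :
  restrict_scale c (restrict_scale d v) = restrict_scale (c * d) v.
Proof. by rewrite /restrict_scale scalerA rmorphM. Qed.

Fact restrict_scale1 : left_id 1 restrict_scale.
Proof. by move=> v; rewrite /restrict_scale rmorph1 scale1r. Qed.

Fact restrict_scaleDr : right_distributive restrict_scale +%R.
Proof. by move=> c v w; rewrite /restrict_scale scalerDr. Qed.

Fact restrict_scaleDl v : {morph restrict_scale^~ v : c d / c + d}.
Proof. by move=> c d; rewrite /restrict_scale rmorphD scalerDl. Qed.

HB.instance Definition _ := GRing.Zmodule_isLmodule.Build K W
  restrict_scaleA restrict_scale1 restrict_scaleDr restrict_scaleDl.
End RestrictScalars.

Definition has_dim (K : fieldType) (V : lmodType K) (d : nat) : Prop :=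
  inhabited (Vector.axiom d V).

(* [Hom_A(U, V)] as an [A]-module. *)
Definition hom_mod (A : comNzRingType) (U V : lmodType A) : Type :=
  {linear U -> V}.

Section Hom.
Variables (A : comNzRingType) (U V : lmodType A).
Local Notation H := (hom_mod U V).

HB.instance Definition _ := gen_eqMixin H.
HB.instance Definition _ := gen_choiceMixin H.

Definition hom_fun (f : H) : U -> V := (f : {linear U -> V}).

Fact hom_ext (f g : H) : hom_fun f =1 hom_fun g -> f = g.
Proof.
rewrite /hom_fun; case: f => f [[fa] [fl]]; case: g => g [[ga] [gl]] /= fg.
have e : f = g by apply/funext.
subst g.
by congr (GRing.Linear.Pack (GRing.Linear.Class _ _)); congr (_ _);
  exact: Prop_irrelevance.
Qed.

Definition hom_zero : H := (\0 : U -> V) : {linear U -> V}.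
Definition hom_opp (f : H) : H :=
  (\- (f : {linear U -> V}) : U -> V) : {linear U -> V}.
Definition hom_add (f g : H) : H :=
  ((f : {linear U -> V}) \+ (g : {linear U -> V}) : U -> V) : {linear U -> V}.
Definition hom_scale (a : A) (f : H) : H :=
  (a \*: (f : {linear U -> V}) : U -> V) : {linear U -> V}.

Fact hom_addA : associative hom_add.
Proof. by move=> f g h; apply: hom_ext => u; exact: addrA. Qed.
Fact hom_addC : commutative hom_add.
Proof. by move=> f g; apply: hom_ext => u; exact: addrC. Qed.
Fact hom_add0 : left_id hom_zero hom_add.
Proof. by move=> f; apply: hom_ext => u; exact: add0r. Qed.
Fact hom_addN : left_inverse hom_zero hom_opp hom_add.
Proof. by move=> f; apply: hom_ext => u; exact: addNr. Qed.

HB.instance Definition _ :=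
  GRing.isZmodule.Build H hom_addA hom_addC hom_add0 hom_addN.

Fact hom_scaleA a b f : hom_scale a (hom_scale b f) = hom_scale (a * b) f.
Proof. by apply: hom_ext => u; exact: scalerA. Qed.
Fact hom_scale1 : left_id 1 hom_scale.
Proof. by move=> f; apply: hom_ext => u; exact: scale1r. Qed.
Fact hom_scaleDr : right_distributive hom_scale +%R.
Proof. by move=> a f g; apply: hom_ext => u; exact: scalerDr. Qed.
Fact hom_scaleDl f : {morph hom_scale^~ f : a b / a + b}.
Proof. by move=> a b; apply: hom_ext => u; exact: scalerDl. Qed.

HB.instance Definition _ := GRing.Zmodule_isLmodule.Build A H
  hom_scaleA hom_scale1 hom_scaleDr hom_scaleDl.
End Hom.

Section IdealModules.
Variables (A : comNzRingType) (J : idealr A).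

Definition ideal_pred : {pred A^o} := fun a => J a.

Fact ideal_pred_submod : submod_closed ideal_pred.
Proof.
split; first exact: (rpred0 J).
move=> a u v uJ vJ; apply: (rpredD (S := J)) => //.
exact: (idealMr (idealrI := J) a uJ).
Qed.
HB.instance Definition _ := GRing.isSubmodClosed.Build A A^o ideal_pred
  ideal_pred_submod.

Record ideal_mod : Type :=
  IdealMod { ideal_val : A^o; ideal_valP : ideal_val \in ideal_pred }.

HB.instance Definition _ := [isSub for ideal_val].
HB.instance Definition _ := [Choice of ideal_mod by <:].
HB.instance Definition _ := [SubChoice_isSubLmodule of ideal_mod by <:].

Definition quot_mod : Type := {ideal_quot J}.
HB.instance Definition _ := GRing.Zmodule.copy quot_mod {ideal_quot J}.

Definition quot_scale (a : A) (q : quot_mod) : quot_mod :=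
  \pi_{ideal_quot J} a * (q : {ideal_quot J}).

Fact quot_scaleA a b q : quot_scale a (quot_scale b q) = quot_scale (a * b) q.
Proof. by rewrite /quot_scale mulrA rmorphM. Qed.
Fact quot_scale1 : left_id 1 quot_scale.
Proof. by move=> q; rewrite /quot_scale rmorph1 mul1r. Qed.
Fact quot_scaleDr : right_distributive quot_scale +%R.
Proof. by move=> a p q; rewrite /quot_scale mulrDr. Qed.
Fact quot_scaleDl q : {morph quot_scale^~ q : a b / a + b}.
Proof. by move=> a b; rewrite /quot_scale rmorphD mulrDl. Qed.

HB.instance Definition _ := GRing.Zmodule_isLmodule.Build A quot_mod
  quot_scaleA quot_scale1 quot_scaleDr quot_scaleDl.
End IdealModules.

Section PolynomialIdeals.
Variables (n : nat) (K : fieldType).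
Local Notation A := {mpoly K[n]}.

(* [idealr A] is the type of proper ideals of [A]; the unit ideal, of degree 0,
   is excluded. *)
Implicit Types (I J : idealr A) (l t : nat) (g m : 'X_{1..n}).

Definition has_degree J l : Prop :=
  has_dim (restrict_scalars (mpolyC n (R := K)) (quot_mod J)) l.

Definition has_tangent_dim J t : Prop :=
  has_dim
    (restrict_scalars (mpolyC n (R := K)) (hom_mod (ideal_mod J) (quot_mod J))) t.

Definition maximal_singularity l I : Prop :=
  has_degree I l /\
  exists2 t, has_tangent_dim I t &
    forall J s, has_degree J l -> has_tangent_dim J s -> (s <= t)%N.

Definition monomial_ideal I : Prop :=
  exists S : {pred 'X_{1..n}}, forall p : A,
    p \in I <->
    exists s : seq (A * 'X_{1..n}),
      all (fun c => c.2 \in S) s /\ p = \sum_(c <- s) c.1 * 'X_[c.2].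

Definition minimal_generator I g : Prop :=
  'X_[g] \in I /\ forall m, 'X_[m] \in I -> (m <= g)%MM -> m = g.

Definition borel_fixed I : Prop :=
  monomial_ideal I /\
  forall g, minimal_generator I g ->
  forall i : 'I_n, (0 < g i)%N ->
  forall j : 'I_n, (j < i)%N -> 'X_[U_(j) + (g - U_(i))] \in I.

Definition pure_power_generator I (i : 'I_n) (e : nat) : Prop :=
  minimal_generator I (U_(i) *+ e)%MM.
End PolynomialIdeals.

Definition ix : 'I_3 := @Ordinal 3 0 isT.
Definition iy : 'I_3 := @Ordinal 3 1 isT.
Definition iz : 'I_3 := @Ordinal 3 2 isT.

(* Main.v *)
From HB Require Import structures.
Require Import Defs.
From mathcomp Require Import all_boot all_order all_algebra.
From mathcomp Require Import ring_quotient mpoly complex reals.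
From mathcomp Require Import boolp zify.

(* A homomorphism I -> R/I is determined by its coefficients c(g, s), the
   coefficient of the standard monomial s in the image of the monomial g, and
   c(g, s) = c(gx, sx) as long as sx is standard. Sliding (g, s) along the z-axis
   (upwards if g lies no higher than s, downwards otherwise) and inside a slice
   reaches one of sum_v (2 n(v_z) + 1) normal positions, where v runs over the
   standard monomials and n(z) is the least x-exponent at height z. For
   Borel-fixed I, n decreases from m1 to 0 in steps of at most one and the slice
   at height z has at least C(n(z) + 1, 2) elements; so, with l the degree,
     T(I) + 2 C(m1 + 2, 4) <= (2 m1 + 1) l  and  C(m1 + 2, 3) <= l.
   The second inequality gives m1 <= k, and if m1 < k the first one gives
   T(I) <= (2k - 1) l - 2 C(k + 1, 4).

   For the listed l some monomial ideal of degree l has a larger tangent space: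
   a power of the maximal ideal (of exponent k or k + 1), enlarged by the
   multiples of some x^a in its top socle degree and with the z-axis cut off p
   steps later. Independent tangent vectors of it are the maps sending one
   minimal generator to one socle monomial, the maps sliding a generator along
   the z-axis, and the multiplications by r / x^a on the multiples of x^a. *)

Set Implicit Arguments.
Unset Strict Implicit.
Unset Printing Implicit Defensive.
Import GRing.Theory.

(** * Staircases in three variables *)

Section Upset.
Variables (P : pred nat) (M : nat).
(** When nothing below M satisfies P, [find] returns M; the hypothesis P M makes this default
    correct. *)
Definition least := find P (iota 0 M).

Hypothesis P_up : forall i, P i -> P i.+1.
Hypothesis P_M : P M.

Lemma leastE i : P i = (least <= i).
Proof.
have up j k : j <= k -> P j -> P k.
  by move=> /subnK <-; elim: (k - j) => // d IHd /IHd /P_up.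
have le_M : least <= M by rewrite -[M in _ <= M](size_iota 0) find_size.
have [le_i|lt_i] := leqP.
  apply: up le_i _; move: le_M; rewrite leq_eqVlt => /predU1P[->//|lt_M].
  have := @nth_find _ 0 P (iota 0 M); rewrite nth_iota //; apply.
  by rewrite has_find size_iota.
have := before_find 0 lt_i; rewrite nth_iota //.
by apply: leq_trans lt_i le_M.
Qed.
End Upset.

Section Staircase.
Variables (D : nat -> nat -> nat -> bool) (M : nat).
Hypothesis D_up1 : forall x y z, D x y z -> D x.+1 y z.
Hypothesis D_up2 : forall x y z, D x y z -> D x y.+1 z.
Hypothesis D_up3 : forall x y z, D x y z -> D x y z.+1.
Hypothesis D_M1 : forall y z, D M y z.
Hypothesis D_M2 : forall x z, D x M z.
Hypothesis D_M3 : forall x y, D x y M.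

Lemma D_le x y z x' y' z' :
  x <= x' -> y <= y' -> z <= z' -> D x y z -> D x' y' z'.
Proof.
have up (P : pred nat) i j : (forall i, P i -> P i.+1) -> i <= j -> P i -> P j.
  by move=> P_up /subnK <-; elim: (j - i) => // d IHd /IHd /P_up.
move=> lex ley lez /(up (fun x => D x y z) _ _ (fun x => @D_up1 x y z) lex).
move=> /(up (fun y => D x' y z) _ _ (fun y => @D_up2 x' y z) ley).
exact: (up (fun z => D x' y' z) _ _ (fun z => @D_up3 x' y' z) lez).
Qed.

Definition order z := least (fun x => D x 0 z) M.
Definition height2 x z := least (fun y => D x y z) M.
Definition height3 x y := least (fun z => D x y z) M.

Lemma orderE x z : D x 0 z = (order z <= x).
Proof. exact: (@leastE (fun x => D x 0 z) M (fun x => @D_up1 x 0 z)). Qed.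
Lemma height2E x y z : D x y z = (height2 x z <= y).
Proof. exact: (@leastE (fun y => D x y z) M (fun y => @D_up2 x y z)). Qed.
Lemma height3E x y z : D x y z = (height3 x y <= z).
Proof. exact: (@leastE (fun z => D x y z) M (fun z => @D_up3 x y z)). Qed.

(** * Sliding coefficients to normal positions *)

Section Vanishing.
Variables (T : Type) (c : nat -> nat -> nat -> nat -> nat -> nat -> T) (o : T).
Hypothesis c_shift : forall g1 g2 g3 t1 t2 t3 e1 e2 e3,
  D g1 g2 g3 -> ~~ D t1 t2 t3 ->
  c (g1 + e1) (g2 + e2) (g3 + e3) t1 t2 t3 =
  if [&& e1 <= t1, e2 <= t2 & e3 <= t3] then
    c g1 g2 g3 (t1 - e1) (t2 - e2) (t3 - e3) else o.
Hypothesis c_up : forall v1 v2 z a, ~~ D v1 v2 z -> a <= order z ->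
  c a (height2 a z) z v1 v2 (height3 v1 v2).-1 = o.
Hypothesis c_down : forall v1 v2 z a, ~~ D v1 v2 z -> a < order z ->
  c v1 v2 (height3 v1 v2) a (height2 a z).-1 z = o.

(** Dividing inside the slice and then climbing one level at a time keeps the coefficient and the
    gap s3 - g3. The climb stops when the target is the top of its z-column, and this happens below
    height M. *)
Lemma coefs_vanish_up g1 g2 g3 s1 s2 s3 : g3 <= s3 ->
  D g1 g2 g3 -> ~~ D s1 s2 s3 -> c g1 g2 g3 s1 s2 s3 = o.
Proof.
have [k] := ubnP (M - s3).
elim: k g1 g2 g3 s1 s2 s3 => // k IHk g1 g2 g3 s1 s2 s3 le_k le_gs Dg Ds.
(* The monomial (a, b, g3) lies in the ideal and divides g. Capping a at [order g3] leaves only the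
   positions covered by [c_up]. *)
pose a := minn g1 (order g3); pose b := height2 a g3.
have Dab : D a b g3 by rewrite height2E.
have le_bg2 : b <= g2.
  rewrite /b -height2E /a; have [//|lt_g1] := leqP g1 (order g3).
  by apply: (@D_le (order g3) 0 g3); rewrite ?orderE.
have le_ag1 : a <= g1 by exact: geq_minl.
have := c_shift (g1 - a) (g2 - b) 0 Dab Ds.
rewrite !subnKC // addn0 => ->; case: ifP => // _; rewrite subn0.
set t1 := s1 - _; set t2 := s2 - _.
have Dt : ~~ D t1 t2 s3.
  by apply: contra Ds; apply: D_le; rewrite ?leq_subr.
(* Either t is the top of its z-column and the position is normal, or both monomials can be
   multiplied by z. *)
have [Dt'|Dt'] := boolP (D t1 t2 s3.+1).
  have -> : s3 = (height3 t1 t2).-1 by move: Dt Dt'; rewrite !height3E; lia.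
  apply: c_up; last exact: geq_minr.
  by apply: contra Dt; apply: D_le.
have lt_s3M : s3.+1 < M.
  by rewrite ltnNge; apply: contra Dt' => le_M; apply: (@D_le t1 t2 M).
have := c_shift 0 0 1 Dab Dt'; rewrite !addn0 !subn0 addn1 subn1 /= => <-.
by apply: IHk => //; [lia | exact: D_up3].
Qed.

(** Here both monomials descend. The descent stops when g is the lowest ideal element of its
    z-column, a normal position, or when s cannot be divided by z and the coefficient is zero. *)
Lemma coefs_vanish_down g1 g2 g3 s1 s2 s3 : s3 < g3 ->
  D g1 g2 g3 -> ~~ D s1 s2 s3 -> c g1 g2 g3 s1 s2 s3 = o.
Proof.
have [k] := ubnP s3.
elim: k g1 g2 g3 s1 s2 s3 => // k IHk g1 g2 g3 s1 s2 s3 le_k lt_sg Dg Ds.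
have lt_s1 : s1 < order s3.
  by rewrite ltnNge -orderE; apply: contra Ds; apply: D_le.
have {}Ds : s2 < height2 s1 s3 by rewrite ltnNge -height2E.
(* Multiplying both monomials by a power of y brings s to the last standard place of its y-column in
   the slice. *)
pose b := (height2 s1 s3).-1; have le_b : s2 <= b by rewrite /b; lia.
have Db : ~~ D s1 b s3 by rewrite height2E /b; lia.
have := c_shift 0 (b - s2) 0 Dg Db.
rewrite !addn0 !leq0n leq_subr !subn0 subKn //= => <-.
have {Dg} : D g1 (g2 + (b - s2)) g3 by apply: D_le Dg; rewrite ?leq_addr.
move: (g2 + (b - s2)) => {}g2 Dg.
have := Dg; rewrite height3E leq_eqVlt => /orP[/eqP eq_g3|lt_g3].
  by rewrite -eq_g3; apply: c_down => //; rewrite height3E eq_g3 -ltnNge.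
(* Now g / z is still in the ideal: the coefficient equals the one for g / z and s / z, or is zero
   when s3 = 0. *)
have g3E : g3 = g3.-1 + 1 by lia.
have Dg' : D g1 g2 g3.-1 by rewrite height3E; lia.
have := c_shift 0 0 1 Dg' Db; rewrite !addn0 -g3E => ->.
case: ifP => // /andP[_ s3_gt0]; rewrite !subn0.
apply: IHk => //; [lia | lia | apply: contra Db].
by apply: D_le; rewrite ?leq_subr.
Qed.

Lemma coefs_vanish g1 g2 g3 s1 s2 s3 :
  D g1 g2 g3 -> ~~ D s1 s2 s3 -> c g1 g2 g3 s1 s2 s3 = o.
Proof.
by have [/coefs_vanish_up|/coefs_vanish_down] := leqP g3 s3; apply.
Qed.
End Vanishing.

(** * Counting standard monomials and normal positions *)

Definition standard : seq (nat * nat * nat) :=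
  [seq v <- [seq (q, z) | z <- iota 0 M,
                          q <- [seq (x, y) | x <- iota 0 M, y <- iota 0 M]]
     | ~~ D v.1.1 v.1.2 v.2].

Lemma standard_uniq : uniq standard.
Proof.
rewrite filter_uniq // allpairs_uniq ?iota_uniq //.
  by rewrite allpairs_uniq ?iota_uniq // => -[? ?] [? ?].
by move=> [? ?] [? ?] _ _ [-> ->].
Qed.

Lemma mem_standard x y z : ((x, y, z) \in standard) = ~~ D x y z.
Proof.
rewrite mem_filter /= andb_idr // => Dxyz.
apply/allpairsP; exists (z, (x, y)); split=> //=.
  rewrite mem_iota /= ltnNge; apply: contra Dxyz => le_Mz.
  by apply: (@D_le x y M).
apply/allpairsP; exists (x, y); split=> //=; rewrite mem_iota /= ltnNge;
  apply: contra Dxyz => le_M.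
- by apply: (@D_le M y z).
- by apply: (@D_le x M z).
Qed.

Definition slice z := \sum_(x < M) \sum_(y < M) ~~ D x y z.

Lemma sum_standard (F : nat -> nat) :
  \sum_(v <- standard) F v.2 = \sum_(z < M) F z * slice z.
Proof.
rewrite big_filter -(big_mkord xpredT (fun z => F z * slice z)).
rewrite big_mkcond big_allpairs_dep /index_iota subn0; apply: eq_bigr => z _.
rewrite big_allpairs_dep /slice -(big_mkord xpredT (fun x => \sum_(y < M) ~~ D x y z)).
rewrite big_distrr /index_iota subn0; apply: eq_bigr => x _.
rewrite -(big_mkord xpredT (fun y => ~~ D x y z : nat)) big_distrr /index_iota subn0.
by apply: eq_bigr => y _ /=; case: (D x y z); rewrite ?muln0 ?muln1.
Qed.

(* At height z, the pairs (a, height2 a z) with a <= order z are generators of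
   the slice; those with a < order z, lowered by one, are the y-maximal
   standard monomials, which include its socle. *)
Definition coords : seq ((nat * nat * nat) * (nat * nat * nat)) :=
  flatten [seq
    [seq ((a, height2 a v.2, v.2), (v.1, (height3 v.1.1 v.1.2).-1))
       | a <- iota 0 (order v.2).+1] ++
    [seq ((v.1, height3 v.1.1 v.1.2), (a, (height2 a v.2).-1, v.2))
       | a <- iota 0 (order v.2)]
    | v <- standard].

Lemma size_coords : size coords = \sum_(z < M) (2 * order z + 1) * slice z.
Proof.
rewrite -(sum_standard (fun z => 2 * order z + 1)) size_flatten sumnE !big_map.
apply: eq_bigr => v _.
by rewrite size_cat !size_map !size_iota; lia.
Qed.

Lemma coords_bound q : q \in coords ->
  D q.1.1.1 q.1.1.2 q.1.2 && ~~ D q.2.1.1 q.2.1.2 q.2.2.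
Proof.
case/flatten_mapP => -[[x y] z]; rewrite mem_standard mem_cat => Dv.
case/orP => /mapP[a]; rewrite mem_iota /= => lt_a -> /=.
  by rewrite height2E leqnn /=; move: Dv; rewrite !height3E; lia.
rewrite height3E leqnn /= height2E.
have : ~~ D a 0 z by rewrite orderE; lia.
by rewrite height2E; lia.
Qed.

Lemma sum_nat_widen (F : nat -> nat) n N : n <= N ->
  \sum_(i < n) F i <= \sum_(i < N) F i.
Proof.
move=> le_nN; rewrite (big_ord_widen N F le_nN) big_mkcond.
by apply: leq_sum => i _; case: ifP.
Qed.

(** * Estimates for Borel-fixed staircases *)

Section Borel.
Hypothesis D_borel2 : forall x y z, D x y.+1 z -> D x.+1 y z.
Hypothesis D_borel3 : forall x y z, D x y z.+1 -> D x.+1 y z.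

(** Trading y for x turns an ideal element (x, y) of the slice into (x + y, 0), so the whole
    triangle x + y < [order z] is standard. *)
Lemma borel_slice z : 'C((order z).+1, 2) <= slice z.
Proof.
have triangle x y : x + y < order z -> ~~ D x y z.
  rewrite ltnNge -orderE; apply: contra.
  by elim: y x => [|y IH] x; rewrite ?addn0 // addnS -addSn => /D_borel2/IH.
have le_M : order z <= M by rewrite -orderE.
have column x : order z - x <= \sum_(y < M) ~~ D x y z.
  apply: leq_trans (sum_nat_widen (fun y => ~~ D x y z) (_ : order z - x <= M)).
    rewrite -[leqLHS]muln1 -[in leqLHS](card_ord (order z - x)) -sum_nat_const.
    by apply: leq_sum => y _; rewrite triangle //; have := ltn_ord y; lia.
  by rewrite (leq_trans _ le_M) ?leq_subr.
rewrite -bin2_sum big_nat_rev big_mkord big_ord_recr /= add0n subnn addn0.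
apply: leq_trans (sum_nat_widen (fun x => \sum_(y < M) ~~ D x y z) le_M).
by apply: leq_sum => x _; rewrite subSS; exact: column.
Qed.

(** Trading z for x shows that [order] drops by at most one per level. It therefore takes every
    value from [order 0] to 0, and one level is kept for each value. *)
Lemma borel_sum (w : nat -> nat) :
  \sum_(c < (order 0).+1) w c * 'C(c.+1, 2) <= \sum_(z < M) w (order z) * slice z.
Proof.
have order_S z : order z.+1 <= order z <= (order z.+1).+1.
  rewrite -!orderE; apply/andP; split; first by apply: D_up3; rewrite orderE.
  by apply: D_borel3; rewrite orderE.
have orderM : order M = 0 by apply/eqP; rewrite -leqn0 -orderE.
(* Induction downwards from height M, where the order is 0: a new term on the left appears exactly
   at the levels where the order changes. *)
have step d : d <= M -> \sum_(c < (order (M - d)).+1) w c * 'C(c.+1, 2) <=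
    \sum_(M - d <= z < M) w (order z) * slice z.
  elim: d => [|d IH] lt_dM.
    by rewrite subn0 orderM big_ord1 muln0.
  rewrite big_ltn; last by lia.
  have -> : (M - d.+1).+1 = M - d by lia.
  apply: leq_trans (leq_add (leqnn _) (IH (ltnW lt_dM))).
  have := order_S (M - d.+1); have -> : (M - d.+1).+1 = M - d by lia.
  case/andP => le_1; rewrite leq_eqVlt => /predU1P[E|lt2].
    rewrite E big_ord_recr /= addnC leq_add2r leq_mul2l -E.
    by rewrite borel_slice orbT.
  have -> : order (M - d.+1) = order (M - d) by lia.
  exact: leq_addl.
by have := step M (leqnn M); rewrite subnn big_mkord.
Qed.

Lemma size_standard : size standard = \sum_(z < M) slice z.
Proof.
rewrite -sum1_size (sum_standard (fun=> 1)).
by apply: eq_bigr => z _; rewrite mul1n.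
Qed.

Lemma sum_bin (m k : nat) : \sum_(c < m) 'C(c, k) = 'C(m, k.+1).
Proof.
elim: m => [|m IH]; first by rewrite big_ord0.
by rewrite big_ord_recr /= IH binS addnC.
Qed.

Lemma sum_binS (m k : nat) : \sum_(c < m) 'C(c.+1, k.+1) = 'C(m.+1, k.+2).
Proof. by rewrite -sum_bin big_ord_recl bin_small // add0n. Qed.

Lemma borel_size : 'C((order 0).+2, 3) <= size standard.
Proof.
have := borel_sum (fun=> 1); rewrite size_standard.
under eq_bigr => i _ do rewrite mul1n.
under [leqRHS]eq_bigr => i _ do rewrite mul1n.
by rewrite sum_binS.
Qed.

Lemma borel_coords :
  size coords + 2 * 'C((order 0).+2, 4) <= (2 * order 0 + 1) * size standard.
Proof.
have order_le z : order z <= order 0.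
  by rewrite -orderE; apply: (@D_le (order 0) 0 0); rewrite ?orderE.
(* Summing the hockey-stick identity twice turns the binomial into the weighted sum with w(c) =
   [order 0] - c, which makes up for replacing [order z] by [order 0]. *)
have -> : 'C((order 0).+2, 4) =
    \sum_(c < (order 0).+1) (order 0 - c) * 'C(c.+1, 2).
  elim: (order 0) => [|m IH]; first by rewrite big_ord1.
  rewrite big_ord_recr /= subnn mul0n addn0 binS IH.
  rewrite -sum_binS -big_split /=.
  apply: eq_bigr => c _; rewrite subSn ?mulSn 1?addnC //.
  by rewrite -ltnS.
apply: leq_trans (_ :
  size coords + 2 * \sum_(z < M) (order 0 - order z) * slice z <= _).
  by rewrite leq_add2l leq_mul2l borel_sum.
rewrite size_coords size_standard !big_distrr -big_split /=.
apply: leq_sum => z _; have := order_le z; nia.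
Qed.


End Borel.
End Staircase.

(** * Competing monomial ideals *)

Notation triple := (nat * nat * nat)%type.

Definition simplex_ge (n a : nat) : seq triple :=
  [seq (x, y, n - x - y) | x <- iota a (n.+1 - a), y <- iota 0 (n - x).+1].

Lemma simplex_ge_uniq n a : uniq (simplex_ge n a).
Proof.
apply: allpairs_uniq_dep => [|x _|]; rewrite ?iota_uniq //.
by move=> [x y] [x' y'] _ _ [-> ->].
Qed.

Lemma mem_simplex_ge n a x y z :
  ((x, y, z) \in simplex_ge n a) = (a <= x) && (x + y + z == n).
Proof.
apply/allpairsPdep/idP => [[x' [y' [+ + [-> -> ->]]]]|].
  by rewrite !mem_iota; lia.
by move=> h; exists x, y; rewrite !mem_iota; split; [lia|lia|congr (_, _, _); lia].
Qed.

Lemma size_simplex_ge n a : size (simplex_ge n a) = 'C(n.+2 - a, 2).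
Proof.
rewrite size_allpairs_dep sumnE big_map -[a in iota a _]addn0 iotaDl big_map.
have [lt_na|le_an] := ltnP n.+1 a.
  have -> : n.+1 - a = 0 by lia.
  by rewrite big_nil bin_small //; lia.
have -> : n.+2 - a = (n.+1 - a).+1 by lia.
rewrite -bin2_sum -{1}[n.+1 - a]subn0 -/(index_iota 0 (n.+1 - a)).
rewrite big_nat_rev [RHS]big_nat_recl // add0n.
by apply: eq_big_nat => i; rewrite size_iota; lia.
Qed.

Definition simplex_lt (n a : nat) : seq triple :=
  [seq v <- simplex_ge n 0 | v.1.1 < a].

Lemma mem_simplex_lt n a x y z :
  ((x, y, z) \in simplex_lt n a) = (x < a) && (x + y + z == n).
Proof. by rewrite mem_filter mem_simplex_ge. Qed.

Lemma size_simplex_lt n a : size (simplex_lt n a) + 'C(n.+2 - a, 2) = 'C(n.+2, 2).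
Proof.
have := size_simplex_ge n 0; rewrite subn0 => <-.
rewrite -size_simplex_ge -(count_predC (fun v => v.1.1 < a) (simplex_ge n 0)).
rewrite -size_filter; congr (_ + _); rewrite -size_filter; apply: perm_size.
apply: uniq_perm; rewrite ?filter_uniq ?simplex_ge_uniq // => -[[x y] z].
by rewrite mem_filter !mem_simplex_ge /= -leqNgt.
Qed.

Section Family.
Variables (K a p : nat).
Hypotheses (K_gt0 : 0 < K) (a_gt0 : 0 < a).

(* For a > K nothing is cut off in degree K. *)
Definition is_standard (v : triple) :=
  let: (x, y, z) := v in
  [|| x + y + z < K, (x + y + z == K) && (x < a)
    | (x + y == 0) && (z <= K + p)].

(* Moves the end of the z-axis from z^n to z^(n + p). *)
Definition extend (v : triple) : triple :=
  (v.1, if v.1.1 + v.1.2 == 0 then v.2 + p else v.2).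

Lemma extend_inj : injective extend.
Proof.
move=> [[x y] z] [[x' y'] z'] [-> ->].
by case: ifP => _ h; congr (_, _, _); lia.
Qed.

Definition standard_seq : seq triple :=
  flatten [seq simplex_ge n 0 | n <- iota 0 K] ++ simplex_lt K a ++
  [seq (0, 0, z) | z <- iota K.+1 p].

Lemma mem_standard_seq v : (v \in standard_seq) = is_standard v.
Proof.
case: v => [[x y] z]; rewrite !mem_cat mem_simplex_lt /is_standard.
have -> : ((x, y, z) \in [seq (0, 0, z) | z <- iota K.+1 p]) =
          [&& x == 0, y == 0, K < z & z <= K + p].
  apply/mapP/idP => [[z' + [-> -> ->]]|]; first by rewrite mem_iota; lia.
  move=> h; exists z; first by rewrite mem_iota; lia.
  by congr (_, _, _); lia.
have -> : ((x, y, z) \in flatten [seq simplex_ge n 0 | n <- iota 0 K]) =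
          (x + y + z < K).
  apply/flatten_mapP/idP => [[n]|h]; first by rewrite mem_iota mem_simplex_ge; lia.
  by exists (x + y + z); rewrite ?mem_iota ?mem_simplex_ge //=; lia.
lia.
Qed.

Lemma standard_seq_uniq : uniq standard_seq.
Proof.
rewrite cat_uniq; apply/and3P; split.
- elim: K => // n IH; rewrite -addn1 iotaD map_cat flatten_cat cat_uniq IH.
  have -> : flatten [seq simplex_ge m 0 | m <- iota (0 + n) 1] = simplex_ge n 0.
    exact: cats0.
  rewrite simplex_ge_uniq andbT; apply/hasPn => -[[x y] z].
  rewrite mem_simplex_ge => h; apply/negP => /flatten_mapP[m].
  by rewrite mem_iota mem_simplex_ge; lia.
- apply/hasPn => -[[x y] z]; rewrite mem_cat mem_simplex_lt => h.
  apply/negP => /flatten_mapP[m]; rewrite mem_iota mem_simplex_ge => lt_m.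
  by case/orP: h => [|/mapP[z']]; [lia|rewrite mem_iota => + [-> -> ->]; lia].
rewrite cat_uniq filter_uniq ?simplex_ge_uniq // map_inj_uniq ?iota_uniq => [|? ? []//].
rewrite andbT; apply/hasPn => -[[x y] z] /mapP[z'].
by rewrite mem_iota => + [-> -> ->]; rewrite mem_simplex_lt; lia.
Qed.

Lemma size_standard_seq : size standard_seq + 'C(K.+2 - a, 2) = 'C(K + 3, 3) + p.
Proof.
rewrite !size_cat size_map size_iota size_flatten sumnE !big_map.
have -> : \sum_(n <- iota 0 K) size (simplex_ge n 0) = 'C(K.+2, 3).
  rewrite -{1}[K]subn0 -/(index_iota 0 K) big_mkord.
  elim: K => [|n IH]; first by rewrite big_ord0.
  transitivity ('C(n.+2, 3) + size (simplex_ge n 0)); first by rewrite -IH big_ord_recr.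
  by rewrite size_simplex_ge subn0 [RHS]binS.
by rewrite addn3 [X in _ = X + _]binS -(size_simplex_lt K a); lia.
Qed.

(** Minimal generators: the multiples of x^a in degree K, and in degree K + 1 the monomials with
    smaller x-exponent, z^(K + 1) being moved to z^(K + 1 + p). *)
Definition gens : seq triple :=
  simplex_ge K a ++ [seq extend v | v <- simplex_lt K.+1 a].

Definition socle : seq triple :=
  [seq extend v | v <- simplex_lt K a] ++ simplex_ge K.-1 a.

Lemma mem_extend n x y z :
  ((x, y, z) \in [seq extend v | v <- simplex_lt n a]) =
  (x < a) && (if x + y == 0 then z == n + p else x + y + z == n).
Proof.
apply/mapP/idP => [[[[x' y'] z']]|].
  by rewrite mem_simplex_lt => h [-> -> ->]; case: eqP; lia.
case: eqP => xy0 h.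
  exists (x, y, n); rewrite ?mem_simplex_lt /extend /= ?xy0 /=; first by lia.
  by congr (_, _, _); lia.
by exists (x, y, z); rewrite ?mem_simplex_lt /extend /=; case: eqP => //; lia.
Qed.

Lemma mem_gens x y z : ((x, y, z) \in gens) =
  (a <= x) && (x + y + z == K) ||
  (x < a) && (if x + y == 0 then z == K.+1 + p else x + y + z == K.+1).
Proof. by rewrite mem_cat mem_simplex_ge mem_extend. Qed.

Lemma mem_socle x y z : ((x, y, z) \in socle) =
  (x < a) && (if x + y == 0 then z == K + p else x + y + z == K) ||
  (a <= x) && (x + y + z == K.-1).
Proof. by rewrite mem_cat mem_simplex_ge mem_extend. Qed.

Lemma gens_uniq : uniq gens.
Proof.
rewrite cat_uniq simplex_ge_uniq map_inj_uniq ?filter_uniq ?simplex_ge_uniq //.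
  by rewrite andbT; apply/hasPn => -[[x y] z]; rewrite mem_extend mem_simplex_ge; lia.
exact: extend_inj.
Qed.

Lemma socle_uniq : uniq socle.
Proof.
rewrite cat_uniq simplex_ge_uniq map_inj_uniq ?filter_uniq ?simplex_ge_uniq //.
  by rewrite andbT; apply/hasPn => -[[x y] z]; rewrite mem_extend mem_simplex_ge; lia.
exact: extend_inj.
Qed.

Lemma size_gens : size gens + 'C(K + 3 - a, 2) = 'C(K + 2 - a, 2) + 'C(K + 3, 2).
Proof.
by rewrite size_cat size_simplex_ge size_map -addnA addn2 addn3 size_simplex_lt.
Qed.

Lemma size_socle : size socle + 'C(K + 2 - a, 2) = 'C(K + 2, 2) + 'C(K + 1 - a, 2).
Proof.
rewrite size_cat size_simplex_ge size_map addn1 addn2 prednK //.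
by rewrite -(size_simplex_lt K a); lia.
Qed.

End Family.

(** * Three kinds of tangent vectors, given by 0-1 coefficients *)

Section Homs.
Variables (K a p : nat).
Hypotheses (K_gt0 : 0 < K) (a_gt0 : 0 < a).
Local Notation is_standard := (is_standard K a p).

Definition socle_fun (g s g' s' : triple) : bool := (g' == g) && (s' == s).

Definition tail_fun (g s g' s' : triple) : bool :=
  [&& g'.1 == g.1, g.2 <= g'.2, s'.1 == s.1 & s'.2 + g.2 == s.2 + g'.2].

(** Multiplication by s / g, restricted to the multiples of the x-power in g. The quotient has a
    negative x-exponent, so the equalities are written with sums. *)
Definition corner_fun (g s g' s' : triple) : bool :=
  [&& g.1.1 <= g'.1.1, g'.1.1 + s.1.1 == s'.1.1 + g.1.1,
      g'.1.2 + s.1.2 == s'.1.2 + g.1.2 & g'.2 + s.2 == s'.2 + g.2].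

(** Compatibility with multiplication by one variable; [shift_relP] extends it to all monomials. *)
Definition shiftable (c : triple -> triple -> bool) :=
  forall g1 g2 g3 t1 t2 t3 e1 e2 e3, e1 + e2 + e3 = 1 ->
    ~~ is_standard (g1, g2, g3) -> is_standard (t1, t2, t3) ->
    c (g1 + e1, g2 + e2, g3 + e3) (t1, t2, t3) =
    [&& e1 <= t1, e2 <= t2, e3 <= t3 & c (g1, g2, g3) (t1 - e1, t2 - e2, t3 - e3)].

Definition tail_gens : seq triple :=
  [:: (0, 0, K.+1 + p); (0, 1, K)] ++ nseq (1 < a) (1, 0, K).

(* Each pair (x^a z^(K - a), r z^(K - a)) stands for the multiplication by
   r / x^a, of degree -1, on the multiples of x^a. For p > 0 the
   choice r = z^(a - 1) is excluded: it would send multiples of x^a into the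
   prolonged z-axis. *)
Definition corner_homs : seq (triple * triple) :=
  if a <= K then
    [seq ((a, 0, K - a), (r.1, r.2 + (K - a)))
       | r <- simplex_ge a.-1 0 & (p == 0) || (0 < r.1.1 + r.1.2)]
  else [::].

Lemma tripleE (v w : triple) :
  (v == w) = [&& v.1.1 == w.1.1, v.1.2 == w.1.2 & v.2 == w.2].
Proof.
by case: v w => [[? ?] ?] [[? ?] ?]; rewrite -!pair_eqE /= /pair_eq /= -andbA.
Qed.

Lemma unit_cases e1 e2 e3 : e1 + e2 + e3 = 1 ->
  [\/ [/\ e1 = 1, e2 = 0 & e3 = 0], [/\ e1 = 0, e2 = 1 & e3 = 0] |
      [/\ e1 = 0, e2 = 0 & e3 = 1]].
Proof.
case: e1 e2 e3 => [|[|//]] [|[|//]] [|[|//]] //= _;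
  by [apply: Or31|apply: Or32|apply: Or33].
Qed.

(** A minimal generator is no proper multiple of an ideal element, and a socle monomial is no proper
    divisor of a standard one, so both sides are false. *)
Lemma socle_shift g s : g \in gens K a p -> s \in socle K a p ->
  shiftable (socle_fun g s).
Proof.
case: g s => [[x y] z] [[x' y'] z']; rewrite mem_gens // mem_socle // => hg hs.
move=> g1 g2 g3 t1 t2 t3 e1 e2 e3 e_1 Dg Dt.
rewrite /socle_fun !tripleE /=.
have -> : [&& g1 + e1 == x, g2 + e2 == y & g3 + e3 == z] = false.
  apply/negP => h; move: hg Dg; case: ifP; rewrite /is_standard; lia.
rewrite /=; apply/esym/negP => h.
by move: hs Dt; case: ifP; rewrite /is_standard; lia.
Qed.

(** The bound K <= i makes x z^i and y z^i ideal elements, so only multiplication by z can act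
    nontrivially on the images. *)
Lemma tail_shift g i : g \in tail_gens -> K <= i -> shiftable (tail_fun g (0, 0, i)).
Proof.
case: g => [[x y] z]; rewrite mem_cat !inE mem_nseq lt0b !tripleE /= => hg le_Ki.
move=> g1 g2 g3 t1 t2 t3 e1 e2 e3 e_1 Dg Dt.
rewrite /tail_fun /= -!pair_eqE /= /pair_eq /=.
case: (unit_cases e_1) => -[-> -> ->]; rewrite ?addn0 ?subn0 ?addn1 ?subn1 ?leq0n /=;
  by apply/idP/idP => h; move: hg Dg Dt; rewrite /is_standard; lia.
Qed.

(** The delicate case is an ideal element of x-exponent a - 1 multiplied by x. It has degree at
    least K + 1, so the product would go to degree at least K + 1; such a target is in the ideal, as
    the prolonged z-axis is avoided. *)
Lemma corner_shift c : c \in corner_homs -> shiftable (corner_fun c.1 c.2).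
Proof.
rewrite /corner_homs; case: leqP => // le_aK /mapP[[[r1 r2] r3]].
rewrite mem_filter mem_simplex_ge /= => hr ->.
move=> g1 g2 g3 t1 t2 t3 e1 e2 e3 e_1 Dg Dt; rewrite /corner_fun /=.
case: (unit_cases e_1) => -[-> -> ->]; rewrite ?addn0 ?subn0 ?addn1 ?subn1 ?leq0n /=;
  by apply/idP/idP => h; move: hr Dg Dt; rewrite /is_standard; lia.
Qed.

End Homs.

(** * Size and independence of the family *)

Section Family.
Variables (K a p : nat).
Hypotheses (K_gt0 : 0 < K) (a_gt0 : 0 < a).
Local Notation is_standard := (is_standard K a p).

(* A tagged pair (g, s) is both a map and the coefficient testing it; the
   corner maps come first because they may be nonzero at the other tests. *)
Definition family : seq (nat * (triple * triple)) :=
  [seq (0, c) | c <- corner_homs K a p] ++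
  [seq (1, (g, s)) | g <- gens K a p, s <- socle K a p] ++
  [seq (2, (g, (0, 0, i))) | g <- tail_gens K a p, i <- iota K p].

Definition family_fun (t : nat * (triple * triple)) : triple -> triple -> bool :=
  match t.1 with
  | 0 => corner_fun t.2.1 t.2.2
  | 1 => socle_fun t.2.1 t.2.2
  | _ => tail_fun t.2.1 t.2.2
  end.

Lemma family_cases t : t \in family ->
  [\/ exists2 c, c \in corner_homs K a p & t = (0, c),
      exists g s, [/\ g \in gens K a p, s \in socle K a p & t = (1, (g, s))] |
      exists g i, [/\ g \in tail_gens K a p, K <= i < K + p & t = (2, (g, (0, 0, i)))]].
Proof.
rewrite 2!mem_cat => /or3P[/mapP[c ? ->]|/allpairsP[[g s] [? ? ->]]|].
- by apply: Or31; exists c.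
- by apply: Or32; exists g, s.
move/allpairsP => [[g i] [? + ->]]; rewrite mem_iota => ?.
by apply: Or33; exists g, i.
Qed.

Lemma family_shift t : t \in family -> shiftable K a p (family_fun t).
Proof.
case/family_cases => [[c ? ->]|[g [s [? ? ->]]]|[g [i [? /andP[? _] ->]]]].
- exact: corner_shift.
- exact: socle_shift.
- exact: tail_shift.
Qed.

Lemma tail_gens_uniq : uniq (tail_gens K a p).
Proof. by rewrite /tail_gens; case: (1 < a); rewrite //= !inE !tripleE /=; lia. Qed.

Lemma corner_homs_uniq : uniq (corner_homs K a p).
Proof.
rewrite /corner_homs; case: ifP => // _.
rewrite map_inj_uniq ?filter_uniq ?simplex_ge_uniq //.
by move=> [[x y] z] [[x' y'] z'] [-> -> h]; congr (_, _, _); lia.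
Qed.

Lemma family_uniq : uniq family.
Proof.
rewrite cat_uniq; apply/and3P; split.
- by rewrite map_inj_uniq ?corner_homs_uniq => [|? ? []].
- apply/hasPn => t; rewrite mem_cat => /orP[] /allpairsP[? [_ _ ->]];
    by apply/mapP => -[].
rewrite cat_uniq; apply/and3P; split.
- by rewrite allpairs_uniq ?gens_uniq ?socle_uniq // => -[? ?] [? ?] _ _ [-> ->].
- by apply/hasPn => t /allpairsP[? [_ _ ->]]; apply/allpairsP => -[? []].
by rewrite allpairs_uniq ?tail_gens_uniq ?iota_uniq // => -[? ?] [? ?] _ _ [-> ->].
Qed.

Lemma size_family : size family =
  size (corner_homs K a p) + size (gens K a p) * size (socle K a p) +
  (2 + (1 < a)) * p.
Proof.
rewrite 2!size_cat size_map 2!size_allpairs size_iota addnA; congr (_ + _ * _).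
by rewrite size_cat size_nseq.
Qed.

(** There are C(a + 1, 2) monomials r of degree a - 1, and only r = z^(a - 1) can be excluded. *)
Lemma size_corner_homs : a <= K -> 'C(a.+1, 2) <= size (corner_homs K a p) + (0 < p).
Proof.
move=> le_aK; rewrite /corner_homs le_aK size_map.
have -> : 'C(a.+1, 2) = size (simplex_ge a.-1 0).
  by rewrite size_simplex_ge prednK // subn0.
rewrite -(count_predC (fun r => (p == 0) || (0 < r.1.1 + r.1.2)) (simplex_ge _ _)).
rewrite size_filter leq_add2l; case: p => [|p'].
  by rewrite (@eq_count _ _ pred0) ?count_pred0.
rewrite -size_filter -[leqRHS]/(size [:: (0, 0, a.-1)]); apply: uniq_leq_size.
  by rewrite filter_uniq ?simplex_ge_uniq.
move=> [[x y] z]; rewrite mem_filter mem_simplex_ge mem_seq1 tripleE /=; lia.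
Qed.

Lemma family_test t : t \in family ->
  [/\ ~~ is_standard t.2.1, is_standard t.2.2 & family_fun t t.2.1 t.2.2].
Proof.
case/family_cases => [[c + ->]|[g [s [+ + ->]]]|[g [i [+ le_i ->]]]] /=.
- rewrite /corner_homs; case: leqP => // le_aK /mapP[[[r1 r2] r3]].
  rewrite mem_filter mem_simplex_ge /= => hr ->.
  by rewrite /family_fun /= /corner_fun /is_standard /=; split; lia.
- case: g s => [[x y] z] [[x' y'] z']; rewrite mem_gens // mem_socle // => hg hs.
  rewrite /family_fun /= /socle_fun !tripleE /=; split; last by rewrite !eqxx.
    by move: hg; case: ifP; rewrite /is_standard; lia.
  by move: hs; case: ifP; rewrite /is_standard; lia.
case: g => [[x y] z]; rewrite mem_cat !inE mem_nseq lt0b !tripleE /= => hg.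
rewrite /family_fun /= /tail_fun !eqxx leqnn; split => //; rewrite /is_standard; lia.
Qed.

(** This makes the matrix of values at the test pairs triangular: off the diagonal, only a corner
    map at a test of another kind can be nonzero. *)
Lemma family_triangular t u : t \in family -> u \in family ->
  family_fun u t.2.1 t.2.2 -> u = t \/ (u.1 = 0 /\ 0 < t.1).
Proof.
case/family_cases => [[c + ->]|[g [s [+ + ->]]]|[g [i [+ le_i ->]]]] /=.
- rewrite /corner_homs; case: (leqP a K) => // le_aK /mapP[[[r1 r2] r3]].
  rewrite mem_filter mem_simplex_ge /= => hr ->.
  case/family_cases => [[c' + ->]|[g [s [+ + ->]]]|[g [i [+ le_i ->]]]] /=.
  + rewrite /corner_homs le_aK => /mapP[[[r1' r2'] r3'] _ ->].
    rewrite /family_fun /= /corner_fun /= => h.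
    by left; congr (_, (_, (_, _, _))); lia.
  + case: g s => [[x y] z] [[x' y'] z']; rewrite mem_gens // mem_socle // => _ hs.
    rewrite /family_fun /= /socle_fun !tripleE /= => h; exfalso.
    by move: hs; case: ifP; lia.
  + case: g => [[x y] z]; rewrite mem_cat !inE mem_nseq lt0b !tripleE /= => hg.
    rewrite /family_fun /= /tail_fun /= -!pair_eqE /= /pair_eq /= => h; exfalso; lia.
- case: g s => [[x y] z] [[x' y'] z']; rewrite mem_gens // mem_socle // => hg hs.
  case/family_cases => [[c' _ ->]|[g [s [_ _ ->]]]|[g [i [+ le_i ->]]]] /=.
  + by right.
  + by rewrite /family_fun /= /socle_fun => /andP[/eqP <- /eqP <-]; left.
  + case: g => [[x2 y2] z2]; rewrite mem_cat !inE mem_nseq lt0b !tripleE /= => hgi.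
    rewrite /family_fun /= /tail_fun /= -!pair_eqE /= /pair_eq /= => h; exfalso.
    by move: hg hs; case: ifP; case: ifP; lia.
case: g => [[x y] z]; rewrite mem_cat !inE mem_nseq lt0b !tripleE /= => hg.
case/family_cases => [[c' _ ->]|[g [s [_ + ->]]]|[g [i' [+ le_i' ->]]]] /=.
- by right.
- case: s => [[x' y'] z']; rewrite mem_socle // => hs.
  rewrite /family_fun /= /socle_fun => /andP[_ /eqP[? ? ?]]; exfalso.
  by move: hs; case: ifP; lia.
case: g => [[x2 y2] z2]; rewrite mem_cat !inE mem_nseq lt0b !tripleE /= => hgi.
rewrite /family_fun /= /tail_fun /= -!pair_eqE /= /pair_eq /= => h.
by left; congr (_, ((_, _, _), (_, _, _))); lia.
Qed.

End Family.

(** * Binomial estimates *)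

(** These express the estimates through k, C(k + 1, 2), C(k + 2, 3) and C(k + 1, 4), in forms free
    of truncated subtraction. *)
Lemma bin_relations k :
  [/\ 2 * 'C(k + 1, 2) = k * (k + 1), 3 * 'C(k + 2, 3) = (k + 2) * 'C(k + 1, 2),
      4 * 'C(k + 1, 4) + 5 * 'C(k + 2, 3) = k * 'C(k + 2, 3) + 4 * 'C(k + 1, 2) &
  [/\ 'C(k + 2, 2) = 'C(k + 1, 2) + k + 1, 'C(k + 3, 2) = 'C(k + 1, 2) + 2 * k + 3 &
      'C(k + 3, 3) = 'C(k + 2, 3) + 'C(k + 1, 2) + k + 1]].
Proof.
rewrite !addn1 !addn2 !addn3.
have e1 : 2 * 'C(k.+1, 2) = k * k.+1 by rewrite mul_bin_left bin1 subn1.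
have e2 : 'C(k.+2, 2) = 'C(k.+1, 2) + k + 1 by rewrite binS bin1 -addnA addn1.
have e3 : 'C(k.+3, 2) = 'C(k.+1, 2) + 2 * k + 3 by rewrite binS bin1 e2; lia.
have e4 : 3 * 'C(k.+2, 3) = k.+2 * 'C(k.+1, 2) by rewrite mul_bin_left e2; nia.
have e5 : 'C(k.+3, 3) = 'C(k.+2, 3) + 'C(k.+1, 2) + k + 1 by rewrite binS e2; lia.
split=> //; last by split; lia.
have e6 := mul_bin_left k.+1 3; have e7 := binS k.+1 2.
(* For k < 2 the factor k + 1 - 3 is truncated, so these values are checked directly. *)
have [k2|] := leqP 2 k; last by case: (k) => [|[]].
have {}e6 : 4 * 'C(k.+1, 4) + 2 * 'C(k.+1, 3) = k * 'C(k.+1, 3).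
  by rewrite e6 -mulnDl; congr (_ * _); lia.
rewrite e7 in e4 *; nia.
Qed.

(** As a = k + 1 exceeds K = k - 1, nothing is cut: the ideal is the k-th power of the maximal ideal
    with z^k moved to z^(k + p), and all three tail generators occur. *)
Lemma family_size_fat k p : 2 <= k ->
  size (standard_seq k.-1 k.+1 p) = 'C(k + 2, 3) + p /\
  'C(k + 2, 2) * 'C(k + 1, 2) + 3 * p <= size (family k.-1 k.+1 p).
Proof.
move=> k2; have K_gt0 : 0 < k.-1 by lia.
have := size_standard_seq p K_gt0 (ltn0Sn k); have := size_gens k.-1 k.+1 p.
have := size_socle p K_gt0 (ltn0Sn k).
have -> : k.-1 + 3 - k.+1 = 1 by lia.
have -> : k.-1.+2 - k.+1 = 0 by lia.
have -> : k.-1 + 2 - k.+1 = 0 by lia.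
have -> : k.-1 + 1 - k.+1 = 0 by lia.
have -> : k.-1 + 3 = k + 2 by lia.
have -> : k.-1 + 2 = k + 1 by lia.
rewrite bin0n !(@bin_small 1 2) // !addn0 => sS sG sstd; split=> //.
rewrite size_family sS sG; nia.
Qed.

(** The number C(b, 2) counts the monomials of degree k divisible by x^(k + 2 - b). Putting them
    into the ideal lowers the number of generators by b and of socle monomials by b - 1. *)
Lemma family_size_cut k b p : 2 <= b <= k.+1 ->
  size (standard_seq k (k + 2 - b) p) + 'C(b, 2) = 'C(k + 3, 3) + p /\
  ('C(k + 3, 2) - b) * ('C(k + 2, 2) - b.-1) +
    ('C((k + 2 - b).+1, 2) - (0 < p)) + (2 + (1 < k + 2 - b)) * p
     <= size (family k (k + 2 - b) p).
Proof.
move=> hb; have k_gt0 : 0 < k by lia.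
have a_gt0 : 0 < k + 2 - b by lia.
have := size_standard_seq p k_gt0 a_gt0; have := size_gens k (k + 2 - b) p.
have := size_socle p k_gt0 a_gt0; have := size_corner_homs p k_gt0 a_gt0.
have -> : k + 3 - (k + 2 - b) = b.+1 by lia.
have -> : k.+2 - (k + 2 - b) = b by lia.
have -> : k + 2 - (k + 2 - b) = b by lia.
have -> : k + 1 - (k + 2 - b) = b.-1 by lia.
have -> : k + 2 - b <= k by lia.
move=> /(_ isT) sC; rewrite (binS b 1) bin1 => sS sG sstd; split=> //.
have bb : 'C(b, 2) = 'C(b.-1, 2) + b.-1 by case: (b) hb => // c _; rewrite binS bin1.
rewrite size_family; have -> : size (gens k (k + 2 - b) p) = 'C(k + 3, 2) - b by lia.
have -> : size (socle k (k + 2 - b) p) = 'C(k + 2, 2) - b.-1 by lia.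
lia.
Qed.

(* (2 k - 1) l - 2 'C(k + 1, 4) bounds the tangent dimension of the Borel-fixed
   ideals of degree l with m1 < k. *)
Definition beats k l := exists K a p,
  [/\ 0 < K, 0 < a, size (standard_seq K a p) = l &
      (2 * k - 1) * l < size (family K a p) + 2 * 'C(k + 1, 4)].

(** For j = 0 the right side is larger by k(k + 1). Each step along the axis adds 3 maps but raises
    the left side by 2k - 1, a loss of 2(k - 2); the total loss is at most (k - 2)(k + 3) = k(k + 1)
    - 6. *)
Lemma beats_fat k j : 2 <= k -> 2 * j <= k + 3 -> beats k ('C(k + 2, 3) + j).
Proof.
move=> k2 hj; have [sz fam] := family_size_fat j k2.
exists k.-1, k.+1, j; split=> //; first by lia.
have [e1 e2 e3 [e4 _ _]] := bin_relations k; rewrite e4 in fam.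
have f1 : 'C(k + 1, 2) * (2 * 'C(k + 1, 2)) = 'C(k + 1, 2) * (k * (k + 1)).
  by rewrite e1.
have f2 : (k + 1) * (3 * 'C(k + 2, 3)) = (k + 1) * ((k + 2) * 'C(k + 1, 2)).
  by rewrite e2.
have f3 : (k - 2) * (2 * j) <= (k - 2) * (k + 3) by rewrite leq_mul2l hj orbT.
have [m km] : exists m, k = m.+2 by exists (k - 2); lia.
move: sz fam e1 e2 e3 f1 f2 f3; move: 'C(k + 1, 2) 'C(k + 2, 3) 'C(k + 1, 4) => T S C.
rewrite km; move: (size _) => N _; nia.
Qed.

(* Doubling turns the comparison into one that is linear in T = 'C(k + 1, 2),
   since 2 T^2 and (k + 1) * 'C(k + 2, 3) are multiples of T. *)
Lemma cut_bound k b l B E X : 1 <= k -> 1 <= b <= k.+1 -> l + B = 'C(k + 3, 3) + E ->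
  4 * b * 'C(k + 1, 2) + (4 * k - 2) * (k + 1 + E) <
    14 * 'C(k + 1, 2) + 2 * ((2 * k + 3 - b) * (k + 2 - b)) + (4 * k - 2) * B + 2 * X ->
  (2 * k - 1) * l < ('C(k + 3, 2) - b) * ('C(k + 2, 2) - b.-1) + X + 2 * 'C(k + 1, 4).
Proof.
move=> k_gt0 hb hl.
have f0 : (2 * k - 1) * (l + B) = (2 * k - 1) * ('C(k + 3, 3) + E) by rewrite hl.
have [e1 e2 e3 [e4 e5 e6]] := bin_relations k.
have f1 : 'C(k + 1, 2) * (2 * 'C(k + 1, 2)) = 'C(k + 1, 2) * (k * (k + 1)).
  by rewrite e1.
have f2 : (k + 1) * (3 * 'C(k + 2, 3)) = (k + 1) * ((k + 2) * 'C(k + 1, 2)).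
  by rewrite e2.
rewrite e4 e5; rewrite e6 in f0; move: e1 e2 e3 f0 f1 f2 {hl e4 e5 e6}.
move: 'C(k + 1, 2) 'C(k + 2, 3) 'C(k + 1, 4) => T S C.
(* With b = b' + 1 and k = b' + c the truncated subtractions disappear, except 2k - 1, which is
   named u below. *)
have [b' [c [-> kE]]] : exists b' c, b = b'.+1 /\ k = b' + c.
  by exists b.-1, (k - b.-1); lia.
have -> : T + 2 * k + 3 - b'.+1 = T + k + c + 2 by lia.
have -> : T + k + 1 - b'.+1.-1 = T + 1 + c by lia.
have -> : 2 * k + 3 - b'.+1 = k + c + 2 by lia.
have -> : k + 2 - b'.+1 = 1 + c by lia.
rewrite kE in k_gt0 *.
have -> : 4 * (b' + c) - 2 = 2 * (2 * (b' + c) - 1) by lia.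
have : 2 * (b' + c) - 1 + 1 = 2 * (b' + c) by lia.
move: (2 * (b' + c) - 1) => u u1.
have uM x : u * x + x = 2 * (b' + c) * x by rewrite -u1 mulnDl mul1n.
have := uM S; have := uM T; have := uM (b' + c); lia.
Qed.

(** X is any lower bound for the number of corner and tail maps; X = 0 suffices for b = 2, 3 and k +
    1. *)
Lemma beats_cut k b p l X : 2 <= k -> 2 <= b <= k.+1 ->
  l + 'C(b, 2) = 'C(k + 3, 3) + p ->
  X <= ('C((k + 2 - b).+1, 2) - (0 < p)) + (2 + (1 < k + 2 - b)) * p ->
  4 * b * 'C(k + 1, 2) + (4 * k - 2) * (k + 1 + p) <
    14 * 'C(k + 1, 2) + 2 * ((2 * k + 3 - b) * (k + 2 - b)) +
    (4 * k - 2) * 'C(b, 2) + 2 * X ->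
  beats k l.
Proof.
move=> k2 hb hl hX hlt; have [sz fam] := family_size_cut p hb.
have hb1 : 1 <= b <= k.+1 by lia.
have bound := cut_bound (ltnW k2) hb1 hl hlt.
by exists k, (k + 2 - b), p; split; lia.
Qed.

Lemma corner_bin k : 3 <= k -> 2 * 'C(k - 1, 2) = (k - 1) * (k - 2).
Proof. by move=> k3; rewrite mul_bin_left bin1 -subnDA mulnC. Qed.

(** Write j = C(b, 2) - p, with (b, p) = (2, 0), (3, 1), (3, 0), (4, 2) for j = 1, 2, 3, 4. *)
Lemma beats_top k l j : 2 <= k -> 1 <= j <= 4 -> l + j = 'C(k + 3, 3) -> beats k l.
Proof.
move=> k2 hj hl; have [e1 _ _ [_ _ e6]] := bin_relations k.
have b2 : 'C(2, 2) = 1 by []. have b3 : 'C(3, 2) = 3 by [].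
have b4 : 'C(4, 2) = 6 by [].
have [j1|[j2|[j3|j4]]] : j = 1 \/ j = 2 \/ j = 3 \/ j = 4 by lia.
- by apply: (@beats_cut k 2 0 l 0); rewrite ?b2; [lia|lia|lia|lia|nia].
- by apply: (@beats_cut k 3 1 l 0); rewrite ?b3; [lia|lia|lia|lia|nia].
- by apply: (@beats_cut k 3 0 l 0); rewrite ?b3; [lia|lia|lia|lia|nia].
(* The choice b = 4 requires b <= k + 1. For k = 2 the degree is 6 = C(4, 3) + 2, which the other
   construction covers. *)
have [k_eq2|k3] : k = 2 \/ 3 <= k by lia.
  have -> : l = 'C(k + 2, 3) + 2.
    have c1 : 'C(2 + 3, 3) = 10 by []. have c2 : 'C(2 + 2, 3) = 4 by [].
    by move: hl; rewrite k_eq2 c1 c2; lia.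
  by apply: beats_fat; lia.
have eX := corner_bin k3.
(* Here a = k - 2, so there are at least C(k - 1, 2) - 1 corner maps, one r being excluded since p >
   0; two tail generators with p = 2 targets each give 4 more maps. *)
apply: (@beats_cut k 4 2 l (('C(k - 1, 2) - 1) + 4)); rewrite ?b4; [lia|lia|lia| |].
- by rewrite (_ : (k + 2 - 4).+1 = k - 1); lia.
have [m kE] : exists m, k = m + 3 by exists (k - 3); lia.
have [k1 kk] : k - 1 = m + 2 /\ k - 2 = m + 1 by lia.
rewrite k1 kk in eX; rewrite (_ : 2 * k + 3 - 4 = 2 * m + 5); [|lia].
rewrite (_ : k + 2 - 4 = m + 1); [|lia].
rewrite (_ : 4 * k - 2 = 4 * m + 10) ?k1 ?kE; [|lia]; rewrite kE in e1; lia.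
Qed.

(** The values b = 2, 3 are j = 1, 3 of [beats_top]; b = k + 1 is the cut with a = 1; b = k + 2
    gives l = C(k + 2, 3), the degree of a pure power of the maximal ideal. *)
Lemma beats_cut_form k l b : 2 <= k -> b \in [:: 2; 3; 4; k + 1; k + 2] ->
  l + 'C(b, 2) = 'C(k + 3, 3) -> beats k l.
Proof.
move=> k2 hb hl; have [e1 _ _ [e4 _ e6]] := bin_relations k.
have b4 : 'C(4, 2) = 6 by [].
have : b = 2 \/ b = 3 \/ b = 4 \/ b = k + 1 \/ b = k + 2 by move: hb; rewrite !inE; lia.
case=> [bE|[bE|[bE|[bE|bE]]]]; rewrite bE in hl.
- exact: (@beats_top k l 1).
- exact: (@beats_top k l 3).
- have [k_eq2|k3] : k = 2 \/ 3 <= k by lia.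
    have -> : l = 'C(k + 2, 3) + 0.
      have c1 : 'C(2 + 3, 3) = 10 by []. have c2 : 'C(2 + 2, 3) = 4 by [].
      by move: hl; rewrite k_eq2 c1 c2; lia.
    by apply: beats_fat; lia.
  (* For b = 4 the corner maps matter: without them the inequality fails for large k by about k^2,
     and twice their number is (k - 1)(k - 2). *)
  have eX := corner_bin k3.
  apply: (@beats_cut k 4 0 l 'C(k - 1, 2)); rewrite ?b4; [lia|lia|lia| |].
  - by rewrite (_ : (k + 2 - 4).+1 = k - 1); lia.
  have [m kE] : exists m, k = m + 3 by exists (k - 3); lia.
  have [k1 kk] : k - 1 = m + 2 /\ k - 2 = m + 1 by lia.
  rewrite k1 kk in eX; rewrite (_ : 2 * k + 3 - 4 = 2 * m + 5); [|lia].
  rewrite (_ : k + 2 - 4 = m + 1); [|lia].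
  rewrite (_ : 4 * k - 2 = 4 * m + 10) ?k1 ?kE; [|lia]; rewrite kE in e1; lia.
- apply: (@beats_cut k (k + 1) 0 l 0); [lia|lia|lia|lia|].
  have -> : 2 * k + 3 - (k + 1) = k + 2 by lia.
  rewrite (_ : k + 2 - (k + 1) = 1); [nia|lia].
have -> : l = 'C(k + 2, 3) + 0 by lia.
by apply: beats_fat; lia.
Qed.

Local Open Scope ring_scope.
Local Open Scope quotient_scope.

(** * Dimensions *)

Section Dimension.
Variables (K : fieldType) (V : lmodType K).

Lemma has_dim_le (d N : nat) (F : 'I_N -> V -> K) :
    has_dim V d -> (forall i, scalar (F i)) ->
    (forall v, (forall i, F i v = 0) -> v = 0) -> (d <= N)%N.
Proof.
case=> -[v2r lin_v2r [g v2rK gK]] linF F_inj.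
pose f : {linear V -> 'rV[K]_d} :=
  HB.pack v2r (GRing.isLinear.Build _ _ _ _ v2r lin_v2r).
have lin_g : linear g by exact: (@can2_linear _ _ _ f g v2rK gK).
pose h : {linear 'rV[K]_d -> V} :=
  HB.pack g (GRing.isLinear.Build _ _ _ _ g lin_g).
(* Row i lists the functionals at the i-th basis vector; a vector with u A = 0 is killed by all of
   them. *)
pose A := \matrix_(i < d, j < N) F j (g (delta_mx 0 i)).
suff: row_free A by rewrite /row_free => /eqP <-; exact: rank_leq_col.
apply: inj_row_free => u uA0; apply: (can_inj gK).
rewrite -[RHS]/(h 0) linear0; apply: F_inj => j.
pose Fj : {linear V -> K^o} :=
  HB.pack (F j) (GRing.isLinear.Build _ _ _ _ (F j : V -> K^o) (linF j)).
have := congr1 (fun B : 'rV_N => B 0 j) uA0; rewrite !mxE => <-.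
rewrite -[F j _]/((Fj \o h) u) {1}[u]row_sum_delta linear_sum.
by apply: eq_bigr => i _; rewrite linearZ mxE.
Qed.

Lemma has_dim_ge (d N : nat) (E : 'I_N -> V) :
    has_dim V d ->
    (forall a : 'I_N -> K, \sum_i a i *: E i = 0 -> forall i, a i = 0) ->
  (N <= d)%N.
Proof.
case=> -[v2r lin_v2r bij_v2r] freeE.
pose f : {linear V -> 'rV[K]_d} :=
  HB.pack v2r (GRing.isLinear.Build _ _ _ _ v2r lin_v2r).
pose B := \matrix_(i < N) v2r (E i).
suff: row_free B by rewrite /row_free => /eqP <-; exact: rank_leq_col.
apply: inj_row_free => u; rewrite mulmx_sum_row => uB0.
apply/rowP => i; rewrite mxE; move: i; apply: freeE.
apply: (bij_inj bij_v2r); rewrite -[LHS]/(f _) -[RHS]/(f 0) linear0 linear_sum.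
rewrite -[RHS]uB0; apply: eq_bigr => i _.
by rewrite linearZ rowK.
Qed.

(** Maximal singularity compares only ideals whose dimensions are known to exist, so existence is
    proved for the competing ideal. The functionals embed V into row vectors, and a longest family
    with independent images is a basis. *)
Lemma has_dim_exists (N : nat) (F : 'I_N -> V -> K) :
    (forall i, scalar (F i)) ->
    (forall v, (forall i, F i v = 0) -> v = 0) -> exists d, has_dim V d.
Proof.
move=> linF F_inj.
pose f v : 'rV[K]_N := \row_j F j v.
have lin_f : linear f.
  by move=> c u v; apply/rowP => j; rewrite !mxE linF.
pose fl : {linear V -> 'rV[K]_N} :=
  HB.pack f (GRing.isLinear.Build _ _ _ _ f lin_f).
have f_inj v : f v = 0 -> v = 0.
  by move=> fv0; apply: F_inj => i; have /rowP/(_ i) := fv0; rewrite !mxE.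
pose A r (E : 'I_r -> V) := \matrix_(i < r) f (E i).
pose P r := asbool (exists E : 'I_r -> V, row_free (A r E)).
have P0 : exists r, P r.
  exists 0%N; apply/asboolP; exists (fun=> 0).
  by rewrite /row_free -leqn0 rank_leq_row.
have Pmax r : P r -> (r <= N)%N.
  by case/asboolP => E; rewrite /row_free => /eqP <-; exact: rank_leq_col.
have [r /asboolP[E freeE] r_max] := ex_maxnP P0 Pmax.
have fE (u : 'rV_r) : f (\sum_i u 0 i *: E i) = u *m A r E.
  rewrite -[LHS]/(fl _) linear_sum mulmx_sum_row; apply: eq_bigr => i _.
  by rewrite linearZ rowK.
(* Otherwise adjoining v would give r + 1 independent images, against the maximality of r. *)
have f_sub v : (f v <= A r E)%MS.
  apply/negPn/negP => f_nsub.
  suff /r_max : P r.+1 by rewrite ltnn.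
  apply/asboolP; pose E' (i : 'I_(1 + r)) :=
    if split i is inr j then E j else v.
  exists E'; rewrite -[r.+1]/(1 + r)%N; have -> : A (1 + r)%N E' = col_mx (f v) (A r E).
    apply/row_matrixP => i; rewrite rowK /E'.
    case: (split_ordP i) => j ->.
      by rewrite rowKu row_id.
    by rewrite rowKd rowK.
  rewrite -row_leq_rank -addsmxE.
  apply: leq_trans (_ : \rank (A r E) < _)%N; first by rewrite (eqP freeE).
  rewrite ltn_neqAle mxrankS ?addsmxSr // andbT.
  apply: contra f_nsub => /eqP eq_rk.
  have := mxrank_leqif_sup (addsmxSr (f v) (A r E)) => -[_].
  rewrite eq_rk eqxx => /esym.
  by apply: submx_trans; exact: addsmxSl.
exists r; split; exists (fun v => f v *m pinvmx (A r E)).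
  by move=> c u v; rewrite lin_f mulmxDl scalemxAl.
exists (fun u : 'rV_r => \sum_i u 0 i *: E i) => [v|u]; last first.
  by rewrite fE mulmxKp ?freeE.
apply/eqP; rewrite -subr_eq0; apply/eqP/f_inj.
by rewrite -[LHS]/(fl _) linearB /= fE mulmxKpV ?subrr.
Qed.
End Dimension.

(** * Monomial ideals *)

Section MonomialIdeal.
Variables (n : nat) (K : fieldType).
Local Notation A := {mpoly K[n]}.
Implicit Types (J : idealr A) (m e g s t : 'X_{1..n}) (p : A).

Definition monomial_on (D : pred 'X_{1..n}) J :=
  forall p, (p \in J) = all D (msupp p).

Lemma monomial_on_X D J m : monomial_on D J -> ('X_[m] \in J) = D m.
Proof. by move=> ->; rewrite msuppX /= andbT. Qed.

Lemma monomial_on_le D J m m' :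
  monomial_on D J -> (m <= m')%MM -> D m -> D m'.
Proof.
move=> DJ le_mm'; rewrite -!(monomial_on_X _ DJ) => Xm.
by rewrite -(submK le_mm') mpolyXD; exact: idealMr.
Qed.

(** Each monomial in the support of a combination of generators is a multiple of some generator,
    hence in J. *)
Lemma monomial_idealE J :
  monomial_ideal J -> monomial_on [pred m | 'X_[m] \in J] J.
Proof.
case=> S J_S p; apply/idP/allP => [/J_S[s [/allP sS ->]] m|XJ].
  rewrite mcoeff_msupp linear_sum /= => nz.
  have [c cs nz_c] : exists2 c, c \in s & (c.1 * 'X_[c.2])@_m != 0.
    apply/hasP; apply: contraNT nz => /hasPn all0.
    by rewrite big_seq big1 // => c /all0 /negPn/eqP.
  have le_cm : (c.2 <= m)%MM.
    move: nz_c; rewrite -mcoeff_msupp (perm_mem (msuppMX _ _)) => /mapP[m' _ ->].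
    exact: lem_addr.
  have XcJ : 'X_[c.2] \in J.
    apply/J_S; exists [:: (1, c.2)]; rewrite /= sS //; split => //.
    by rewrite big_seq1 mul1r.
  by rewrite -(submK le_cm) mpolyXD; exact: idealMr.
rewrite [p]mpolyE big_seq; apply: rpred_sum => m /XJ /= XmJ.
by rewrite -mul_mpolyC; exact: idealMr.
Qed.

(** The coefficient is read off a chosen representative; it is independent of the choice only for
    standard s. *)
Definition coefq J s (q : quot_mod J) : K := (repr (q : {ideal_quot J}))@_s.

Variables (D : pred 'X_{1..n}) (J : idealr A).
Hypothesis DJ : monomial_on D J.

Lemma coefq_pi s p : ~~ D s -> coefq s (\pi_{ideal_quot J} p : quot_mod J) = p@_s.
Proof.
move=> Ds; apply/eqP; rewrite -subr_eq0 -mcoeffB mcoeff_eq0.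
apply: contra Ds => s_in; move: (DJ (repr (\pi_{ideal_quot J} p) - p)).
by rewrite Quotient.idealrBE reprK eqxx => /esym/allP/(_ _ s_in).
Qed.

Lemma coefq_linear s : ~~ D s ->
  scalar (coefq s : restrict_scalars (mpolyC n (R := K)) (quot_mod J) -> K).
Proof.
move=> Ds c u v; rewrite -[u]/(u : {ideal_quot J}) -[v]/(v : {ideal_quot J}).
have -> : c *: u + v =
    \pi_{ideal_quot J} (c%:MP * repr (u : {ideal_quot J}) + repr (v : {ideal_quot J})).
  by rewrite rmorphD rmorphM /= !reprK.
by rewrite coefq_pi // mcoeffD mcoeffCM.
Qed.

Lemma coefq_inj (q : quot_mod J) : (forall s, ~~ D s -> coefq s q = 0) -> q = 0.
Proof.
move=> q0; rewrite -[q](reprK (q : {ideal_quot J})).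
apply/eqP; rewrite -[0]/(0 : {ideal_quot J}) -(rmorph0 (\pi_{ideal_quot J})).
rewrite -Quotient.idealrBE subr0 DJ; apply/allP => s.
by rewrite mcoeff_msupp; apply: contraR => Ds; apply/eqP/q0.
Qed.

Lemma coefq_eq (q q' : quot_mod J) :
  (forall s, ~~ D s -> coefq s q = coefq s q') -> q = q'.
Proof.
move=> qq'; apply/eqP; rewrite -subr_eq0; apply/eqP/coefq_inj => s Ds.
pose f : {linear restrict_scalars (mpolyC n (R := K)) (quot_mod J) -> K^o} :=
  HB.pack (coefq s : _ -> K^o)
    (GRing.isLinear.Build _ _ _ _
       (coefq s : restrict_scalars (mpolyC n (R := K)) (quot_mod J) -> K^o)
       (coefq_linear Ds)).
by have := linearB f q q'; rewrite /= qq' // subrr.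
Qed.

Lemma coefq_scaleX t e (q : quot_mod J) : ~~ D t ->
  coefq t ('X_[e] *: q) = if (e <= t)%MM then coefq (t - e) q else 0.
Proof.
move=> Dt; have -> : 'X_[e] *: q =
    \pi_{ideal_quot J} ('X_[e] * repr (q : {ideal_quot J})) :> quot_mod J.
  by rewrite rmorphM /= reprK.
rewrite coefq_pi // mulrC; case: ifPn => [le_et|/negP not_et].
  by rewrite -{1}(submK le_et) addmC mcoeffMX.
apply/eqP; rewrite mcoeff_eq0 (perm_mem (msuppMX _ _)); apply/mapP => -[m _ tE].
by apply: not_et; rewrite tE lem_addr.
Qed.

Local Notation kquot := (restrict_scalars (mpolyC n (R := K)) (quot_mod J)).
Variables (W : seq 'X_{1..n}).
Hypotheses (uniqW : uniq W) (memW : forall m, (m \in W) = ~~ D m).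

Lemma has_degree_exists : exists d, has_degree J d.
Proof.
apply: (@has_dim_exists _ kquot (size W)
          (fun i => coefq (tnth (in_tuple W) i))) => [i|q q0].
  by apply: coefq_linear; rewrite -memW mem_tnth.
apply: coefq_inj => s; rewrite -memW => /(tnthP (in_tuple W))[i ->]; exact: q0.
Qed.

Lemma has_degree_size d : has_degree J d -> d = size W.
Proof.
move=> Jd; apply/eqP; rewrite eqn_leq; apply/andP; split.
  apply: (@has_dim_le _ kquot _ _ (fun i => coefq (tnth (in_tuple W) i)) Jd)
    => [i|q q0].
    by apply: coefq_linear; rewrite -memW mem_tnth.
  apply: coefq_inj => s; rewrite -memW => /(tnthP (in_tuple W))[i ->]; exact: q0.
pose E i : quot_mod J := \pi_{ideal_quot J} 'X_[tnth (in_tuple W) i].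
apply: (@has_dim_ge _ kquot _ _ E Jd) => a aE0 i.
pose p := \sum_j a j *: 'X_[tnth (in_tuple W) j].
have <- : p@_(tnth (in_tuple W) i) = a i.
  rewrite linear_sum (bigD1 i) //= big1 => [|j ji].
    by rewrite mcoeffZ mcoeffX eqxx mulr1 addr0.
  by rewrite mcoeffZ mcoeffX (inj_eq (tuple_uniqP _ _)) ?(negPf ji) ?mulr0.
have Di : ~~ D (tnth (in_tuple W) i) by rewrite -memW mem_tnth.
rewrite -coefq_pi //.
suff -> : \pi_{ideal_quot J} p = \sum_j a j *: (E j : kquot).
  have pi0 : \pi_{ideal_quot J} 0 = 0 :> kquot by exact: rmorph0.
  rewrite aE0 -pi0.
  by rewrite coefq_pi ?mcoeff0.
rewrite rmorph_sum; apply: eq_bigr => j _.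
by rewrite -mul_mpolyC rmorphM.
Qed.

End MonomialIdeal.

(** * Homomorphisms from a monomial ideal *)

Section MonomialHom.
Variables (n : nat) (K : fieldType).
Local Notation A := {mpoly K[n]}.
Implicit Types (m e g s t : 'X_{1..n}) (p : A).

Definition shift_rel (D : pred 'X_{1..n}) (c : 'X_{1..n} -> 'X_{1..n} -> K) :=
  forall g t e, D g -> ~~ D t ->
    c (g + e)%MM t = if (e <= t)%MM then c g (t - e)%MM else 0.

(** Induction on the degree of e, splitting off one variable at a time. *)
Lemma shift_relP (D : pred 'X_{1..n}) (c : 'X_{1..n} -> 'X_{1..n} -> K) :
    (forall g e, D g -> D (g + e)%MM) ->
    (forall t e, ~~ D t -> ~~ D (t - e)%MM) ->
    (forall g t i, D g -> ~~ D t ->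
      c (g + U_(i))%MM t = if (0 < t i)%N then c g (t - U_(i))%MM else 0) ->
  shift_rel D c.
Proof.
move=> Dup Ddown c1 g t e; have [k] := ubnP (mdeg e).
elim: k e g t => // k IHk e g t le_ek Dg Dt.
have [->|e0] := eqVneq e 0%MM.
  have -> : (0 <= t)%MM by apply/mnm_lepP => i; rewrite mnm0E.
  by rewrite addm0 subm0.
have [i ei] : exists i, (0 < e i)%N.
  apply/existsP; apply: contraNT e0; rewrite negb_exists => /forallP all0.
  by apply/eqP/mnmP => i; rewrite mnm0E; apply/eqP; move: (all0 i); rewrite lt0n negbK.
have le_ie : (U_(i) <= e)%MM.
  by apply/mnm_lepP => j; rewrite mnm1E; case: eqP => // <-.
rewrite -(submK le_ie) addmA c1 ?Dup // (addmC (e - _)%MM) -submDA.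
have lt_e'k : (mdeg (e - U_(i)) < k)%N.
  by rewrite -ltnS (leq_trans _ le_ek) // -{2}(submK le_ie) mdegD mdeg1 addn1.
case: ifPn => [ti|ti].
  rewrite IHk ?Ddown //.
  have le_it : (U_(i) <= t)%MM.
    by apply/mnm_lepP => j; rewrite mnm1E; case: eqP => // <-.
  suff -> : (e - U_(i) <= t - U_(i))%MM = (U_(i) + (e - U_(i)) <= t)%MM by [].
  apply/mnm_lepP/mnm_lepP => le j; move: (le j) (mnm_lepP le_it j);
    by rewrite mnmDE !mnmBE; lia.
case: ifP => // /mnm_lepP/(_ i); rewrite mnmDE mnm1E eqxx => h.
by move: ti; rewrite (leq_trans _ h).
Qed.

Variables (D : pred 'X_{1..n}) (J : idealr A).
Hypothesis DJ : monomial_on D J.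
Local Notation khom :=
  (restrict_scalars (mpolyC n (R := K)) (hom_mod (ideal_mod J) (quot_mod J))).

(** The default 0 outside J makes phi a function of plain polynomials, without membership proofs. *)
Definition hom_hat (phi : hom_mod (ideal_mod J) (quot_mod J)) p : quot_mod J :=
  if insub (p : A^o) is Some u then hom_fun phi u else 0.

Lemma hom_hat_val phi (u : ideal_mod J) : hom_hat phi (val u) = hom_fun phi u.
Proof. by rewrite /hom_hat valK. Qed.

Lemma hom_hatE phi p (pJ : (p : A^o) \in ideal_pred J) :
  hom_hat phi p = hom_fun phi (IdealMod pJ).
Proof. exact: hom_hat_val phi (IdealMod pJ). Qed.

Lemma hom_hatM phi a p : p \in J -> hom_hat phi (a * p) = a *: hom_hat phi p.
Proof.
move=> pJ; pose u := IdealMod (pJ : (p : A^o) \in ideal_pred J).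
have -> : hom_hat phi p = hom_fun phi u by exact: (hom_hat_val phi u).
have -> : hom_hat phi (a * p) = hom_fun phi (a *: u).
  exact: (hom_hat_val phi (a *: u)).
exact: (linearZZ (phi : {linear ideal_mod J -> quot_mod J}) a u).
Qed.

Definition hcoef (phi : hom_mod (ideal_mod J) (quot_mod J)) g s : K :=
  coefq s (hom_hat phi 'X_[g]).

Lemma hcoef_shift phi : shift_rel D (hcoef phi).
Proof.
move=> g t e Dg Dt; rewrite /hcoef addmC mpolyXD hom_hatM.
  exact: (coefq_scaleX DJ).
by rewrite (monomial_on_X _ DJ).
Qed.

Lemma hcoef_linear g s : D g -> ~~ D s ->
  scalar ((fun phi => hcoef phi g s) : khom -> K).
Proof.
move=> Dg Ds c f h; rewrite /hcoef.
have XgJ : ('X_[g] : A^o) \in ideal_pred J by rewrite -(monomial_on_X g DJ) in Dg.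
rewrite !(hom_hatE _ XgJ); exact: (coefq_linear DJ Ds).
Qed.

Lemma hcoef_inj (phi : khom) :
  (forall g s, D g -> ~~ D s -> hcoef phi g s = 0) -> phi = 0.
Proof.
move=> phi0; apply: hom_ext => -[p pJ].
have [Dp] : all D (msupp (p : A)) by rewrite -DJ.
(* Every monomial of p lies in J, so the expansion takes place inside J and the default of [insubd]
   is never reached. *)
have -> : IdealMod pJ = \sum_(m <- msupp (p : A))
    ((p : A)@_m)%:MP *: (insubd 0 ('X_[m] : A^o) : ideal_mod J).
  apply: val_inj; rewrite [RHS]linear_sum.
  transitivity (p : A); first by [].
  rewrite {1}[p](mpolyE (p : A)) big_seq [RHS]big_seq.
  apply: eq_bigr => m /(allP Dp) Dm.
  have XmJ : ('X_[m] : A^o) \in ideal_pred J by rewrite -(monomial_on_X m DJ) in Dm.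
  have valE : \val (insubd 0 ('X_[m] : A^o) : ideal_mod J) = 'X_[m] := insubdK 0 XmJ.
  by rewrite [RHS]linearZZ /= -[ideal_val _]/(\val _) valE -mul_mpolyC.
transitivity (\sum_(m <- msupp (p : A)) ((p : A)@_m)%:MP *:
    hom_fun phi (insubd 0 ('X_[m] : A^o) : ideal_mod J)).
  by rewrite /hom_fun linear_sum; apply: eq_bigr => m _; rewrite linearZZ.
rewrite big_seq big1 // => m /(allP Dp) Dm.
suff -> : hom_fun phi (insubd 0 ('X_[m] : A^o) : ideal_mod J) = 0.
  exact: scaler0.
apply: (coefq_inj DJ) => s Ds; rewrite -[RHS](phi0 m s Dm Ds) /hcoef.
have XmJ : ('X_[m] : A^o) \in ideal_pred J by rewrite -(monomial_on_X m DJ) in Dm.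
by rewrite -hom_hat_val insubdK.
Qed.

Variables (W : seq 'X_{1..n}).
Hypotheses (uniqW : uniq W) (memW : forall m, (m \in W) = ~~ D m).

(** * Building a homomorphism from its coefficients *)

Section FromCoefficients.
Variable c : 'X_{1..n} -> 'X_{1..n} -> K.
Hypothesis c_shift : shift_rel D c.

Let row t p : K := \sum_(m <- msupp p) p@_m * c m t.

Let rowE t p (r : seq 'X_{1..n}) : uniq r -> {subset msupp p <= r} ->
  row t p = \sum_(m <- r) p@_m * c m t.
Proof.
move=> uniq_r sub_r; rewrite [RHS](bigID (mem (msupp p))) /=.
rewrite [X in _ + X]big1 => [|m /memN_msupp_eq0->]; last by rewrite mul0r.
rewrite addr0 -big_filter; apply: perm_big; apply: uniq_perm => //.
  exact: filter_uniq.
by move=> m; rewrite mem_filter /= andb_idr //; exact: sub_r.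
Qed.

Let row_linear t : scalar (row t).
Proof.
move=> a p q; pose r := undup (msupp (a *: p + q) ++ msupp p ++ msupp q).
have sub_r (s : seq 'X_{1..n}) :
    {subset s <= msupp (a *: p + q) ++ msupp p ++ msupp q} -> {subset s <= r}.
  by move=> sub m /sub; rewrite mem_undup.
rewrite !(@rowE _ _ r) ?undup_uniq //; try by
  apply: sub_r => m; rewrite !mem_cat => ->; rewrite ?orbT.
rewrite mulr_sumr -big_split; apply: eq_bigr => m _.
by rewrite mcoeffD mcoeffZ mulrDl mulrA.
Qed.

Let rowX t g : row t 'X_[g] = c g t.
Proof. by rewrite /row msuppX big_seq1 mcoeffX eqxx mul1r. Qed.

Let Phi p : quot_mod J := \pi_{ideal_quot J} (\sum_(t <- W) row t p *: 'X_[t]).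

Let coef_Phi t p : ~~ D t -> coefq t (Phi p) = row t p.
Proof.
move=> Dt; rewrite (coefq_pi DJ) // linear_sum /=.
rewrite (bigD1_seq t) ?memW //= mcoeffZ mcoeffX eqxx mulr1 big1 ?addr0 // => s.
by rewrite mcoeffZ mcoeffX => /negPf->; rewrite mulr0.
Qed.

Local Notation kquot := (restrict_scalars (mpolyC n (R := K)) (quot_mod J)).

Let Phi_linear : linear (Phi : A -> kquot).
Proof.
move=> a p q.
rewrite -[X in _ = X + _]/(\pi_{ideal_quot J} a%:MP * Phi p : {ideal_quot J}).
rewrite /Phi -rmorphM -rmorphD.
congr (\pi_{ideal_quot J} _); rewrite mul_mpolyC scaler_sumr -big_split.
by apply: eq_bigr => t _; rewrite row_linear scalerDl scalerA.
Qed.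

(** Compared coefficient by coefficient, this is [shift_rel] applied to each monomial of p; all of
    them lie in J. *)
Let PhiX e p : p \in J -> Phi ('X_[e] * p) = 'X_[e] *: Phi p.
Proof.
move=> pJ; apply: (coefq_eq DJ) => t Dt; rewrite (coefq_scaleX DJ) // coef_Phi //.
pose rowl : {linear A -> K^o} :=
  HB.pack (row t) (GRing.isLinear.Build _ _ _ _ (row t : A -> K^o) (row_linear t)).
rewrite {1}[p]mpolyE mulr_sumr -[row t _]/(rowl _) linear_sum.
have Dp : all D (msupp p) by rewrite -DJ.
have Dte : ~~ D (t - e)%MM.
  by apply: contra Dt; apply: (monomial_on_le DJ); exact: lem_subr.
have -> : (if (e <= t)%MM then coefq (t - e) (Phi p) else 0) =
    \sum_(m <- msupp p) p@_m * if (e <= t)%MM then c m (t - e)%MM else 0.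
  case: ifP => _; first by rewrite coef_Phi.
  by rewrite big1 // => m _; rewrite mulr0.
rewrite big_seq [RHS]big_seq; apply: eq_bigr => m /(allP Dp) Dm.
rewrite -scalerAr -mpolyXD linearZ /= rowX addmC; congr (_ * _).
exact: c_shift.
Qed.

Let PhiM a p : p \in J -> Phi (a * p) = a *: Phi p.
Proof.
move=> pJ.
pose Phil : {linear A -> kquot} :=
  HB.pack (Phi : A -> kquot)
    (GRing.isLinear.Build _ _ _ _ (Phi : A -> kquot) Phi_linear).
rewrite {1}[a]mpolyE mulr_suml -[Phi _]/(Phil _) linear_sum.
rewrite [a in RHS]mpolyE scaler_suml; apply: eq_bigr => m _.
by rewrite -scalerAl linearZ /= PhiX // -mul_mpolyC -scalerA.
Qed.

Lemma hom_of_coefs : exists phi : hom_mod (ideal_mod J) (quot_mod J),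
  forall g t, D g -> ~~ D t -> hcoef phi g t = c g t.
Proof.
pose f (u : ideal_mod J) := Phi (val u).
have lin_f : linear f.
  move=> a u v; rewrite /f -(PhiM _ (valP u : val u \in J)).
  have := Phi_linear 1 (a * val u) (val v); rewrite !scale1r => <-.
  by rewrite linearP.
pose fl : {linear ideal_mod J -> quot_mod J} :=
  HB.pack f (GRing.isLinear.Build _ _ _ _ f lin_f).
exists fl => g t Dg Dt.
have XgJ : ('X_[g] : A^o) \in ideal_pred J by rewrite -(monomial_on_X g DJ) in Dg.
rewrite /hcoef (hom_hatE _ XgJ).
by rewrite -[hom_fun _ _]/(Phi 'X_[g]) coef_Phi.
Qed.
End FromCoefficients.

(** * Bounding the tangent dimension by coefficients *)

Section CoordinateBound.
Variable Q : seq ('X_{1..n} * 'X_{1..n}).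
Hypothesis Q_DD : forall q, q \in Q -> D q.1 && ~~ D q.2.
Hypothesis Q_inj : forall c, shift_rel D c ->
  (forall q, q \in Q -> c q.1 q.2 = 0) -> forall g s, D g -> ~~ D s -> c g s = 0.

Let F (i : 'I_(size Q)) (phi : khom) :=
  hcoef phi (tnth (in_tuple Q) i).1 (tnth (in_tuple Q) i).2.

Let F_linear i : scalar (F i).
Proof. by have /andP[? ?] := Q_DD (mem_tnth i (in_tuple Q)); exact: hcoef_linear. Qed.

Let F_inj phi : (forall i, F i phi = 0) -> phi = 0.
Proof.
move=> F0; apply: hcoef_inj; apply: (Q_inj (hcoef_shift phi)) => q.
by move=> /(tnthP (in_tuple Q))[i ->]; exact: F0.
Qed.

Lemma tangent_dim_exists : exists d, has_tangent_dim J d.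
Proof. exact: has_dim_exists F_linear F_inj. Qed.

Lemma tangent_dim_le d : has_tangent_dim J d -> (d <= size Q)%N.
Proof. by move=> Jd; exact: has_dim_le Jd F_linear F_inj. Qed.
End CoordinateBound.

Lemma tangent_dim_ge (N d : nat) (c : 'I_N -> 'X_{1..n} -> 'X_{1..n} -> K) :
    (forall i, shift_rel D (c i)) ->
    (forall a : 'I_N -> K,
      (forall g s, D g -> ~~ D s -> \sum_i a i * c i g s = 0) ->
      forall i, a i = 0) ->
  has_tangent_dim J d -> (N <= d)%N.
Proof.
move=> c_shift c_free Jd.
have /choice[E cE] i := hom_of_coefs (c_shift i).
apply: (@has_dim_ge _ khom _ _ E Jd) => a aE0; apply: c_free => g s Dg Ds.
pose h : {linear khom -> K^o} :=
  HB.pack (fun phi : khom => hcoef phi g s : K^o)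
    (GRing.isLinear.Build _ _ _ _ (fun phi : khom => hcoef phi g s : K^o)
       (hcoef_linear Dg Ds)).
transitivity (h 0); last exact: linear0.
rewrite -aE0 linear_sum; apply: eq_bigr => i _.
by rewrite linearZ /= cE.
Qed.

End MonomialHom.

(** * Three variables *)

Definition mnm3 (v : triple) : 'X_{1..3} :=
  [multinom nth 0%N [:: v.1.1; v.1.2; v.2] i | i < 3].
Definition triple_of (m : 'X_{1..3}) : triple := (m ix, m iy, m iz).

Lemma ord3P (P : 'I_3 -> Prop) : P ix -> P iy -> P iz -> forall i, P i.
Proof.
move=> Px Py Pz [[|[|[|//]]] lt_i].
- by rewrite (_ : Ordinal lt_i = ix) //; exact: val_inj.
- by rewrite (_ : Ordinal lt_i = iy) //; exact: val_inj.
- by rewrite (_ : Ordinal lt_i = iz) //; exact: val_inj.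
Qed.

Lemma mnm3K : cancel mnm3 triple_of.
Proof. by case=> [[x y] z]; rewrite /triple_of /mnm3 !mnmE. Qed.

Lemma triple_ofK : cancel triple_of mnm3.
Proof. by move=> m; apply/mnmP; apply: ord3P; rewrite mnmE. Qed.

Lemma mnm3D x y z x' y' z' :
  mnm3 (x + x', y + y', z + z')%N = (mnm3 (x, y, z) + mnm3 (x', y', z'))%MM.
Proof. by apply/mnmP; apply: ord3P; rewrite mnmDE !mnmE. Qed.

Lemma mnm3B x y z x' y' z' :
  mnm3 (x - x', y - y', z - z')%N = (mnm3 (x, y, z) - mnm3 (x', y', z'))%MM.
Proof. by apply/mnmP; apply: ord3P; rewrite mnmBE !mnmE. Qed.

Lemma lem_mnm3 x y z x' y' z' :
  (mnm3 (x, y, z) <= mnm3 (x', y', z'))%MM = [&& x <= x', y <= y' & z <= z']%N.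
Proof.
apply/mnm_lepP/and3P => [le|[? ? ?]]; last by apply: ord3P; rewrite !mnmE.
by split; [move: (le ix)|move: (le iy)|move: (le iz)]; rewrite !mnmE.
Qed.

(** * The upper bound for ideals in three variables *)

Section Upper.
Variables (F : fieldType) (D : pred 'X_{1..3}) (J : idealr {mpoly F[3]}) (M : nat).
Hypothesis DJ : monomial_on D J.
Local Notation D3 := (fun x y z => D (mnm3 (x, y, z))).
Hypothesis D_M1 : forall y z, D3 M y z.
Hypothesis D_M2 : forall x z, D3 x M z.
Hypothesis D_M3 : forall x y, D3 x y M.

Let D3_le x y z x' y' z' :
  (x <= x')%N -> (y <= y')%N -> (z <= z')%N -> D3 x y z -> D3 x' y' z'.
Proof. by move=> ? ? ?; apply: (monomial_on_le DJ); rewrite lem_mnm3; apply/and3P. Qed.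

Let up1 x y z : D3 x y z -> D3 x.+1 y z. Proof. exact: D3_le. Qed.
Let up2 x y z : D3 x y z -> D3 x y.+1 z. Proof. exact: D3_le. Qed.
Let up3 x y z : D3 x y z -> D3 x y z.+1. Proof. exact: D3_le. Qed.

Let Q := [seq (mnm3 q.1, mnm3 q.2) | q <- coords D3 M].

Let Q_DD q : q \in Q -> D q.1 && ~~ D q.2.
Proof.
case/mapP => -[[[? ?] ?] [[? ?] ?]] /= q_in ->.
exact: (coords_bound up1 up2 up3 D_M1 D_M2 D_M3 q_in).
Qed.

Let Q_inj c : shift_rel (K := F) D c -> (forall q, q \in Q -> c q.1 q.2 = 0) ->
  forall g s, D g -> ~~ D s -> c g s = 0.
Proof.
move=> c_shift c0 g s.
rewrite -[g]triple_ofK -[s]triple_ofK.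
case: (triple_of g) (triple_of s) => [[g1 g2] g3] [[s1 s2] s3].
pose c3 g1 g2 g3 s1 s2 s3 := c (mnm3 (g1, g2, g3)) (mnm3 (s1, s2, s3)).
have mem_Q v1 v2 z q : ~~ D3 v1 v2 z -> q \in
    [seq ((a, height2 D3 M a z, z), ((v1, v2), (height3 D3 M v1 v2).-1))
       | a <- iota 0 (order D3 M z).+1] ++
    [seq (((v1, v2), height3 D3 M v1 v2), (a, (height2 D3 M a z).-1, z))
       | a <- iota 0 (order D3 M z)] -> c (mnm3 q.1) (mnm3 q.2) = 0.
  move=> Dv q_in; apply: (c0 (mnm3 q.1, mnm3 q.2)); apply: map_f.
  apply/flatten_mapP; exists (v1, v2, z) => //.
  by rewrite (mem_standard up1 up2 up3 D_M1 D_M2 D_M3).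
apply: (@coefs_vanish D3 M up1 up2 up3 D_M1 D_M2 D_M3 _ c3 0).
- move=> h1 h2 h3 t1 t2 t3 e1 e2 e3 Dh Dt.
  by rewrite /c3 mnm3D c_shift // lem_mnm3 mnm3B.
- move=> v1 v2 z a Dv le_a; apply: (mem_Q _ _ _ (_, _) Dv).
  by rewrite mem_cat; apply/orP; left; apply/mapP; exists a; rewrite // mem_iota.
- move=> v1 v2 z a Dv lt_a; apply: (mem_Q _ _ _ (_, _) Dv).
  by rewrite mem_cat; apply/orP; right; apply/mapP; exists a; rewrite // mem_iota.
Qed.

Let W := [seq mnm3 v | v <- standard D3 M].

Let W_uniq : uniq W.
Proof. by rewrite map_inj_uniq ?standard_uniq //; exact: can_inj mnm3K. Qed.

Let mem_W m : (m \in W) = ~~ D m.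
Proof.
rewrite -[m]triple_ofK mem_map; last exact: can_inj mnm3K.
exact: (mem_standard up1 up2 up3 D_M1 D_M2 D_M3).
Qed.

Lemma degree3_exists : exists d, has_degree J d.
Proof. exact: (has_degree_exists DJ mem_W). Qed.

Lemma degree3 d : has_degree J d -> d = size (standard D3 M).
Proof. by move/(has_degree_size DJ W_uniq mem_W); rewrite size_map. Qed.

Lemma tangent3_exists : exists d, has_tangent_dim J d.
Proof. exact: (tangent_dim_exists DJ Q_DD Q_inj). Qed.

Lemma tangent3_le d : has_tangent_dim J d -> (d <= size (coords D3 M))%N.
Proof. by move/(tangent_dim_le DJ Q_DD Q_inj); rewrite size_map. Qed.
End Upper.

Lemma monomial_on_exists (n : nat) (F : fieldType) (D : pred 'X_{1..n}) :
    (forall m m', (m <= m')%MM -> D m -> D m') -> ~~ D 0%MM ->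
  exists J : idealr {mpoly F[n]}, monomial_on D J.
Proof.
move=> D_up D0; pose S (p : {mpoly F[n]}) : bool := all D (msupp p).
have S_closed : idealr_closed S.
  split; first by rewrite unfold_in /S msupp0.
    by rewrite unfold_in /S msupp1 /= andbT.
  move=> a p q; rewrite !unfold_in /S => /allP Dp /allP Dq; apply/allP => m.
  move=> /msuppD_le; rewrite mem_cat => /orP[/msuppM_le|/Dq//].
  by case/allpairsP => -[m1 m2] /= [_ /Dp Dm2 ->]; apply: D_up Dm2; exact: lem_addl.
pose J : idealr {mpoly F[n]} := HB.pack S (isIdealr.Build _ S S_closed).
by exists J.
Qed.

(** * Realizing the competing ideals *)

Section Lower.
Variables (F : fieldType) (K a p : nat).
Hypotheses (K_gt0 : (0 < K)%N) (a_gt0 : (0 < a)%N).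

Let D : pred 'X_{1..3} := fun m => ~~ is_standard K a p (triple_of m).

Let D_up m m' : (m <= m')%MM -> D m -> D m'.
Proof.
move=> /mnm_lepP le; move: (le ix) (le iy) (le iz).
rewrite /D /is_standard /triple_of; lia.
Qed.

Let shift c : shiftable K a p c ->
  shift_rel D (fun g s => (c (triple_of g) (triple_of s))%:R : F).
Proof.
move=> c_shift; apply: shift_relP => [g e|t e|g t i].
- by apply: D_up; exact: lem_addr.
- by apply: contra; apply: D_up; exact: lem_subr.
have e_sum :
    ((triple_of U_(i)).1.1 + (triple_of U_(i)).1.2 + (triple_of U_(i)).2 = 1)%N.
  by move: i; apply: ord3P; rewrite /triple_of /= !mnm1E.
have lt_i : (0 < t i)%N = [&& (triple_of U_(i)).1.1 <= t ix,
    (triple_of U_(i)).1.2 <= t iy & (triple_of U_(i)).2 <= t iz]%N.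
  move: (i); apply: ord3P; rewrite /triple_of /= !mnm1E /= ?andbT //.
move=> Dg /negPn Dt; set e := triple_of _ in e_sum lt_i.
have := c_shift _ _ _ _ _ _ _ _ _ e_sum Dg Dt.
have -> : triple_of (g + U_(i))%MM = (g ix + e.1.1, g iy + e.1.2, g iz + e.2)%N.
  by rewrite /triple_of !mnmDE.
have -> : triple_of (t - U_(i))%MM = (t ix - e.1.1, t iy - e.1.2, t iz - e.2)%N.
  by rewrite /triple_of !mnmBE.
move=> ->; rewrite lt_i; case: (leqP e.1.1 _) => //= _; case: (leqP e.1.2 _) => //= _.
by case: (leqP e.2 _).
Qed.

Lemma family_tangent_ge (J : idealr {mpoly F[3]}) d : monomial_on D J ->
  has_tangent_dim J d -> (size (family K a p) <= d)%N.
Proof.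
move=> DJ; pose t i := tnth (in_tuple (family K a p)) i.
have t_in i : t i \in family K a p by exact: mem_tnth.
pose W := [seq mnm3 v | v <- standard_seq K a p].
have W_uniq : uniq W.
  by rewrite map_inj_uniq ?standard_seq_uniq //; exact: can_inj mnm3K.
have mem_W m : (m \in W) = ~~ D m.
  rewrite -[m]triple_ofK mem_map; last exact: can_inj mnm3K.
  by rewrite mem_standard_seq // /D mnm3K negbK.
pose c (i : 'I_(size (family K a p))) (g s : 'X_{1..3}) : F :=
  (family_fun (t i) (triple_of g) (triple_of s))%:R.
apply: (tangent_dim_ge DJ W_uniq mem_W (c := c)).
- by move=> i; apply: shift; exact: family_shift.
move=> x x0.
have eval i : \sum_j x j * (family_fun (t j) (t i).2.1 (t i).2.2)%:R = 0.
  have [Dg Ds _] := family_test K_gt0 a_gt0 (t_in i).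
  have := x0 (mnm3 (t i).2.1) (mnm3 (t i).2.2); rewrite /D !mnm3K negbK.
  move=> /(_ Dg Ds) sum0; rewrite -[RHS]sum0.
  by apply: eq_bigr => j _; rewrite /c !mnm3K.
have t_inj : injective t by apply/tuple_uniqP; exact: family_uniq.
(* Triangular elimination: at a corner test only the diagonal term survives, so the corner
   coefficients vanish first, and then all others. *)
have step i : (forall j, (t j).1 = 0%N -> (0 < (t i).1)%N -> x j = 0) -> x i = 0.
  move=> x_low; have := eval i; rewrite (bigD1 i) //= big1 => [|j ji].
    have [_ _ ->] := family_test K_gt0 a_gt0 (t_in i).
    by rewrite mulr1 addr0.
  case: (boolP (family_fun _ _ _)) => [|_]; last by rewrite mulr0.
  case/(family_triangular K_gt0 a_gt0 (t_in i) (t_in j)) => [/t_inj ij|[tj ti]].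
    by rewrite ij eqxx in ji.
  by rewrite x_low ?mul0r.
have x_corner i : (t i).1 = 0%N -> x i = 0 by move=> ti; apply: step; rewrite ti.
by move=> i; apply: step => j tj _; exact: x_corner.
Qed.

Lemma family_ideal l : (size (standard_seq K a p) = l)%N ->
  exists J : idealr {mpoly F[3]}, has_degree J l /\
    exists2 d, has_tangent_dim J d & (size (family K a p) <= d)%N.
Proof.
move=> size_l.
have [J DJ] : exists J : idealr {mpoly F[3]}, monomial_on D J.
  apply: monomial_on_exists D_up _.
  by rewrite /D negbK /triple_of !mnm0E /is_standard K_gt0.
(* No exponent of a standard monomial exceeds K + p. *)
pose M := (K + p).+1.
have D_standard x y z : D (mnm3 (x, y, z)) = ~~ is_standard K a p (x, y, z).
  by rewrite /D mnm3K.
have D_M1 y z : D (mnm3 (M, y, z)) by rewrite D_standard /is_standard /M; lia.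
have D_M2 x z : D (mnm3 (x, M, z)) by rewrite D_standard /is_standard /M; lia.
have D_M3 x y : D (mnm3 (x, y, M)) by rewrite D_standard /is_standard /M; lia.
exists J; split.
  have [d Jd] := degree3_exists DJ D_M1 D_M2 D_M3.
  suff -> : l = d by [].
  rewrite (degree3 DJ D_M1 D_M2 D_M3 Jd) -size_l; apply: perm_size.
  have D_le x y z x' y' z' : (x <= x')%N -> (y <= y')%N -> (z <= z')%N ->
      D (mnm3 (x, y, z)) -> D (mnm3 (x', y', z')).
    by move=> ? ? ?; apply: D_up; rewrite lem_mnm3; apply/and3P.
  apply: uniq_perm; rewrite ?standard_seq_uniq ?standard_uniq // => -[[x y] z].
  rewrite mem_standard_seq // mem_standard // ?D_standard ?negbK // => u v w;
    exact: D_le.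
have [d Jd] := tangent3_exists DJ D_M1 D_M2 D_M3.
by exists d => //; exact: family_tangent_ge Jd.
Qed.
End Lower.

(** * Borel-fixed ideals *)

Section BorelFixed.
Variables (n : nat) (F : fieldType) (I : idealr {mpoly F[n]}).

Lemma minimal_generator_exists m : 'X_[m] \in I ->
  exists2 g, minimal_generator I g & (g <= m)%MM.
Proof.
have [k] := ubnP (mdeg m); elim: k m => // k IHk m le_k mI.
have [m_min|m_notmin] := pselect (minimal_generator I m).
  by exists m => //; exact: lepm_refl.
have [m' [m'I le_m' neq_m']] :
    exists m', [/\ 'X_[m'] \in I, (m' <= m)%MM & m' <> m].
  apply: contrapT => no_m'; apply: m_notmin; split=> // m' m'I le_m'.
  by apply: contrapT => neq_m'; apply: no_m'; exists m'.
have [|g g_min le_g] := IHk m' _ m'I; last by exists g => //; exact: lepm_trans le_m'.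
rewrite -ltnS (leq_trans _ le_k) // ltnS -(submK le_m') mdegD -[ltnLHS]add0n ltn_add2r.
rewrite lt0n mdeg_eq0; apply/eqP => m0; apply: neq_m'.
by rewrite -(submK le_m') m0 add0m.
Qed.

(** The exchange passes from minimal generators to all monomials: a generator g of m x_i either
    divides m, if x_i does not divide g, or x_j g / x_i divides m x_j. *)
Lemma borel_fixed_exchange (i j : 'I_n) m : borel_fixed I -> (j < i)%N ->
  'X_[m + U_(i)] \in I -> 'X_[m + U_(j)] \in I.
Proof.
case=> _ borelI lt_ji /minimal_generator_exists[g g_min /mnm_lepP le_g].
suff [h hI le_h] : exists2 h, 'X_[h] \in I & (h <= m + U_(j))%MM.
  by rewrite -(submK le_h) mpolyXD; exact: idealMr.
case: (posnP (g i)) => [gi0|gi_gt0].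
  exists g; first by case: g_min.
  apply/mnm_lepP => t; have := le_g t; rewrite !mnmDE !mnm1E.
  by case: (eqVneq i t) => [<-|_]; lia.
exists (U_(j) + (g - U_(i)))%MM; first exact: borelI.
apply/mnm_lepP => t; have := le_g t; rewrite !mnmDE mnmBE !mnm1E.
by case: (eqVneq i t) => [<-|_]; lia.
Qed.
End BorelFixed.

Section BorelBound.
Variables (F : fieldType) (I : idealr {mpoly F[3]}) (m1 m2 m3 : nat).
Hypotheses (borelI : borel_fixed I) (hm1 : pure_power_generator I ix m1)
  (hm2 : pure_power_generator I iy m2) (hm3 : pure_power_generator I iz m3).

Let D : pred 'X_{1..3} := [pred m | 'X_[m] \in I].
Let DI : monomial_on D I. Proof. exact: monomial_idealE borelI.1. Qed.
Local Notation D3 := (fun x y z => D (mnm3 (x, y, z))).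
Let M := (m1 + m2 + m3)%N.

Let pure i e : pure_power_generator I i e -> D (U_(i) *+ e)%MM.
Proof. by case. Qed.

Let D_M1 y z : D3 M y z.
Proof.
apply: (monomial_on_le DI) (pure hm1); apply/mnm_lepP; apply: ord3P;
  by rewrite mulmnE mnm1E mnmE /= /M; lia.
Qed.
Let D_M2 x z : D3 x M z.
Proof.
apply: (monomial_on_le DI) (pure hm2); apply/mnm_lepP; apply: ord3P;
  by rewrite mulmnE mnm1E mnmE /= /M; lia.
Qed.
Let D_M3 x y : D3 x y M.
Proof.
apply: (monomial_on_le DI) (pure hm3); apply/mnm_lepP; apply: ord3P;
  by rewrite mulmnE mnm1E mnmE /= /M; lia.
Qed.

Let D3_le x y z x' y' z' :
  (x <= x')%N -> (y <= y')%N -> (z <= z')%N -> D3 x y z -> D3 x' y' z'.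
Proof. by move=> ? ? ?; apply: (monomial_on_le DI); rewrite lem_mnm3; apply/and3P. Qed.

Let up1 x y z : D3 x y z -> D3 x.+1 y z. Proof. exact: D3_le. Qed.
Let up2 x y z : D3 x y z -> D3 x y.+1 z. Proof. exact: D3_le. Qed.
Let up3 x y z : D3 x y z -> D3 x y z.+1. Proof. exact: D3_le. Qed.

Let mnm3_x x y z : mnm3 (x.+1, y, z) = (mnm3 (x, y, z) + U_(ix))%MM.
Proof. by apply/mnmP; apply: ord3P; rewrite mnmDE mnm1E !mnmE /= ?addn0 ?addn1. Qed.
Let mnm3_y x y z : mnm3 (x, y.+1, z) = (mnm3 (x, y, z) + U_(iy))%MM.
Proof. by apply/mnmP; apply: ord3P; rewrite mnmDE mnm1E !mnmE /= ?addn0 ?addn1. Qed.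
Let mnm3_z x y z : mnm3 (x, y, z.+1) = (mnm3 (x, y, z) + U_(iz))%MM.
Proof. by apply/mnmP; apply: ord3P; rewrite mnmDE mnm1E !mnmE /= ?addn0 ?addn1. Qed.

Let borel2 x y z : D (mnm3 (x, y.+1, z)) -> D (mnm3 (x.+1, y, z)).
Proof. by rewrite mnm3_x mnm3_y; exact: borel_fixed_exchange. Qed.
Let borel3 x y z : D (mnm3 (x, y, z.+1)) -> D (mnm3 (x.+1, y, z)).
Proof. by rewrite mnm3_x mnm3_z; exact: borel_fixed_exchange. Qed.

Let order0 : order D3 M 0 = m1.
Proof.
have xE x : mnm3 (x, 0, 0)%N = (U_(ix) *+ x)%MM.
  by apply/mnmP; apply: ord3P; rewrite mulmnE mnm1E mnmE /= ?mul1n.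
have orderE' x : D (mnm3 (x, 0, 0)%N) = (order D3 M 0 <= x)%N.
  exact: (orderE up1 D_M1).
apply/eqP; rewrite eqn_leq -orderE' xE pure //=.
have Dorder : D (U_(ix) *+ order D3 M 0)%MM by rewrite -xE orderE'.
have le_order : (U_(ix) *+ order D3 M 0 <= U_(ix) *+ m1)%MM.
  by rewrite -!xE lem_mnm3 !andbT -orderE' xE pure.
have := hm1.2 _ Dorder le_order => /(congr1 (fun m : 'X_{1..3} => m ix)).
by rewrite !mulmnE mnm1E !mul1n => ->.
Qed.

Lemma borel_degree l : has_degree I l -> ('C(m1 + 2, 3) <= l)%N.
Proof.
move/(degree3 DI D_M1 D_M2 D_M3) ->; rewrite addn2 -order0.
exact: (borel_size up1 up3 D_M1 D_M3 borel2 borel3).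
Qed.

Lemma borel_tangent_le l t : has_degree I l -> has_tangent_dim I t ->
  (t + 2 * 'C(m1 + 2, 4) <= (2 * m1 + 1) * l)%N.
Proof.
move/(degree3 DI D_M1 D_M2 D_M3) -> => /(tangent3_le DI D_M1 D_M2 D_M3) le_t.
apply: leq_trans (_ : size (coords D3 M) + 2 * 'C(m1 + 2, 4) <= _)%N.
  by rewrite leq_add2r.
rewrite addn2 -order0.
exact: (borel_coords up1 up2 up3 D_M1 D_M3 borel2 borel3).
Qed.

(** An [idealr] is proper, so x^0 = 1 is not in it. *)
Lemma pure_power_gt0 : (0 < m1)%N.
Proof.
rewrite lt0n; apply/eqP => m10; case: hm1 => + _.
by rewrite m10 mulm0n mpolyX0 idealr1.
Qed.
End BorelBound.

(** * Comparing the two bounds *)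

Theorem theoremB (R : realType) (k l : nat)
    (hk : (1 <= k)%N)
    (hl : ('C(k + 2, 3) <= l < 'C(k + 3, 3))%N)
    (hform :
      (exists j : nat, (2 * j <= k + 3)%N /\ l = ('C(k + 2, 3) + j)%N) \/
      (exists j : nat, (1 <= j <= 4)%N /\ (l + j)%N = 'C(k + 3, 3)) \/
      (exists b : nat, b \in [:: 2; 3; 4; k + 1; k + 2]%N /\
                       (l + 'C(b, 2))%N = 'C(k + 3, 3)))
    (I : idealr {mpoly (complex R)[3]})
    (hIdeg : has_degree I l)
    (hIborel : borel_fixed I)
    (m1 m2 m3 : nat)
    (hm1 : pure_power_generator I ix m1)
    (hm2 : pure_power_generator I iy m2)
    (hm3 : pure_power_generator I iz m3)
    (hm : (m1 <= m2 <= m3)%N)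
    (hImax : maximal_singularity l I) :
  m1 = k.
Proof.
have m1_gt0 := pure_power_gt0 hm1.
have deg_m1 := borel_degree hIborel hm1 hm2 hm3 hIdeg.
have [le_k lt_k] := andP hl.
have [lt_m1|gt_m1|//] := ltngtP m1 k; last first.
  have := leq_trans deg_m1 (ltnW lt_k).
  have : ('C(k + 3, 3) <= 'C(m1 + 2, 3))%N by apply: leq_bin2l; lia.
  by move=> ?; have := leq_ltn_trans deg_m1 lt_k; lia.
have k2 : (2 <= k)%N by lia.
have [K [a [p [K_gt0 a_gt0 size_l]]]] : beats k l.
  case: hform => [[j [hj ->]]|[[j [hj lj]]|[b [hb lb]]]].
  - exact: beats_fat.
  - exact: beats_top hj lj.
  - exact: beats_cut_form hb lb.
rewrite ltnNge => /negP; case; case: hImax => _ [t It t_max].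
have [J [Jl [s Js le_s]]] := family_ideal (complex R) K_gt0 a_gt0 size_l.
apply: leq_trans (_ : t + 2 * 'C(k + 1, 4) <= _)%N.
  by rewrite leq_add2r; exact: leq_trans le_s (t_max _ _ Jl Js).
have := borel_tangent_le hIborel hm1 hm2 hm3 hIdeg It.
(* The bound (2m + 1) l - 2 C(m + 2, 4) grows with m below k: one step adds 2 l - 2 C(m + 2, 3),
   which is nonnegative. So m1 may be replaced by k - 1. *)
have mono d : (m1 + d < k)%N -> ((2 * m1 + 1) * l + 2 * 'C(m1 + d + 2, 4) <=
    (2 * (m1 + d) + 1) * l + 2 * 'C(m1 + 2, 4))%N.
  elim: d => [|d IHd] lt_d; first by rewrite addn0.
  rewrite addnS in lt_d *; have {}IHd := IHd (ltnW lt_d).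
  have : ('C(m1 + d + 2, 3) <= l)%N by apply: leq_trans le_k; apply: leq_bin2l; lia.
  by rewrite addSn binS; nia.
have := mono (k - m1).-1; rewrite (_ : m1 + (k - m1).-1 = k.-1)%N; last by lia.
rewrite (_ : k.-1 + 2 = k + 1)%N; last by lia.
rewrite (_ : 2 * k.-1 + 1 = 2 * k - 1)%N; last by lia.
lia.
Qed.
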